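(* Let $k>1$ and $N\ge 1$ be integers, and let $f\in S_{2k}(\Gamma_0(N))$ be a normalized cuspidal eigenform of weight $2k$ and level $N$, with coefficient field $K$ and ring of integers $\mathcal{O}_K$. Let $M_f\ge 1$ be a natural number such that for every prime $p\nmid M_f$, either $a_f(p)=0$ or $a_f(p^r)\neq 0$ for all $r\ge 1$, and put $N_f:=\mathrm{lcm}(N,M_f)$. Let $\mathfrak{q}$ be a prime ideal of $\mathcal{O}_K$ lying above $2$ with ramification index $e(\mathfrak{q}/2)$. Let $E$ be an elliptic curve over $\mathbb{Q}$ of conductor $N_E$ which has a cyclic rational $4$-isogeny, and let $f_E$ be the weight $2$ cuspidal eigenform of level $N_E$ corresponding to $E$. If $f\equiv f_E \pmod{\mathfrak{q}^m}$ for some integer $m>e(\mathfrak{q}/2)$, then $$ i_f(n)\ll n^{1/4} $$ for all $n\gg 0$, where the implied constant depends only on $N_fN_E$. That is, there is a constant $C>0$ depending only on $N_fN_E$ such that $i_f(n)\le C n^{1/4}$ for all sufficiently large integers $n$.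
   Context: For a cusp form $f(z)=\sum_{n\ge 1} a_f(n)q^n$ and $n\in\mathbb{N}$, define $i_f(n) := \max\{ i : a_f(n+j)=0 \text{ for all } 0\le j\le i\}$ (with $i_f(n)=0$ if $a_f(n)\neq 0$). An elliptic curve $E/\mathbb{Q}$ has a cyclic rational $4$-isogeny if there is an isogeny $\varphi:E\to E'$ of elliptic curves defined over $\mathbb{Q}$ with $\ker(\varphi)(\overline{\mathbb{Q}})\cong \mathbb{Z}/4\mathbb{Z}$. For an elliptic curve $E/\mathbb{Q}$ of conductor $N_E$, $f_E$ denotes the normalized cuspidal eigenform of weight $2$ and level $N_E$ with rational (integer) Fourier coefficients corresponding to $E$ by the modularity theorem. Two formal power series $f_1,f_2\in \mathcal{O}_K[[q]]$ are congruent modulo $\mathfrak{q}^m$, written $f_1\equiv f_2\pmod{\mathfrak{q}^m}$, if for every $n$ the difference of their $n$-th coefficients lies in $\mathfrak{q}^m$. A natural number $M_f$ with the stated property exists for every normalized cuspidal eigenform $f$ (Kowalski–Robert–Wu). *)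

(* Defs.v *)
From HB Require Import structures.
From mathcomp Require Import all_boot all_order all_algebra all_fingroup all_field.
From mathcomp Require Import all_classical all_reals all_analysis.
From mathcomp.real_closed Require Import complex.
From mathcomp.multinomials Require mpoly.
Import -(notations) mpoly.

Set Implicit Arguments.
Unset Strict Implicit.
Unset Printing Implicit Defensive.

Import Order.TTheory GRing.Theory Num.Theory numFieldNormedType.Exports.

Local Open Scope classical_set_scope.
Local Open Scope ring_scope.
Local Open Scope complex_scope.

(** * Rings of integers and ideals of subfields of a field *)

Section Ideals.
Variable F : fieldType.
Implicit Types (K O I P : set F).

Definition ring_of_integers K : set F :=
  [set x | K x /\ integralOver (intr : int -> F) x].

Definition is_ideal O I :=
  [/\ I `<=` O, I 0, forall x y, I x -> I y -> I (x + y)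
    & forall x y, O x -> I y -> I (x * y)].

Definition is_prime_ideal O P :=
  [/\ is_ideal O P, ~ P 1
    & forall x y, O x -> O y -> P (x * y) -> P x \/ P y].

Definition lies_above P (p : nat) :=
  forall z : int, P z%:~R <-> (p%:Z %| z)%Z.

Definition ideal_mul I J : set F :=
  [set x | exists s : seq (F * F),
     (forall u, u \in s -> I u.1 /\ J u.2) /\ x = \sum_(u <- s) u.1 * u.2].

Fixpoint ideal_exp O I (m : nat) : set F :=
  if m is m'.+1 then ideal_mul I (ideal_exp O I m') else O.

(* The largest e with p O contained in P^e; the powers of P decrease, so it is
   enough to rule out e + 1. *)
Definition is_ramification_index O P (p e : nat) :=
  ideal_exp O P e p%:R /\ ~ ideal_exp O P e.+1 p%:R.

Definition congruent_mod I (a b : nat -> F) := forall n, I (a n - b n).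

(* The subfield generated by the coefficients. *)
Definition coefficient_field (a : nat -> F) : set F :=
  [set x | forall S : {pred F}, divring_closed S ->
     (forall n, a n \in S) -> x \in S].

End Ideals.

(** * Cusp forms and Hecke eigenforms *)

Section ModularForms.
Variable R : realType.
Implicit Types (f : R[i] -> R[i]) (z : R[i]) (a : nat -> R[i]).

Definition upper_half_plane : set R[i] := [set z | 0 < complex.Im z].

(* exp (2 i pi z / h) *)
Definition qpar (h : nat) z : R[i] :=
  (expR (- (2 * pi * complex.Im z / h%:R)))%:C *
  (cos (2 * pi * complex.Re z / h%:R) +i* sin (2 * pi * complex.Re z / h%:R)).

(* f z = \sum_n a n exp (2 i pi n z / h) on the upper half-plane. *)
Definition has_fourier_expansion (h : nat) f a :=
  forall z, upper_half_plane z ->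
    series (fun n => a n * qpar h z ^+ n : R[i]^o) @ \oo --> (f z : R[i]^o).

Definition slash (w : nat) f (a b c d : int) : R[i] -> R[i] := fun z =>
  (c%:~R * z + d%:~R) ^- w *
  f ((a%:~R * z + b%:~R) / (c%:~R * z + d%:~R)).

(* S_w(Gamma_0(N)).  As Gamma(N) is contained in Gamma_0(N) and normal in
   SL_2(Z), each f|gamma is N-periodic; vanishing at the cusps means that its
   expansion in exp (2 i pi z / N) has only terms of positive index. *)
Definition is_cusp_form (w N : nat) f :=
  [/\ forall z, upper_half_plane z -> derivable (f : R[i]^o -> R[i]^o) z 1,
      forall a b c d : int, a * d - b * c = 1 -> (N%:Z %| c)%Z ->
        forall z, upper_half_plane z -> slash w f a b c d z = f z
    & forall a b c d : int, a * d - b * c = 1 ->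
        exists2 u : nat -> R[i], u 0%N = 0 &
          has_fourier_expansion N (slash w f a b c d) u].

(* T_n f (z) = n^(w-1) \sum_(a d = n, (a, N) = 1) \sum_(0 <= b < d)
   d^(-w) f ((a z + b) / d), for trivial character. *)
Definition hecke (w N n : nat) f : R[i] -> R[i] := fun z =>
  n%:R ^+ w.-1 *
  \sum_(d <- divisors n | coprime (n %/ d) N) \sum_(b < d)
    d%:R ^- w * f (((n %/ d)%:R * z + b%:R) / d%:R).

Definition is_normalized_cuspidal_eigenform (w N : nat) f a :=
  [/\ is_cusp_form w N f,
      a 0%N = 0 /\ has_fourier_expansion 1 f a,
      forall n, (0 < n)%N -> exists lambda : R[i],
        forall z, upper_half_plane z -> hecke w N n f z = lambda * f z
    & a 1%N = 1].

(* i is the number i_f(n) attached to the sequence of coefficients a. *)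
Definition is_gap a (n i : nat) :=
  (a n != 0 -> i = 0%N) /\
  (a n = 0 ->
    (forall j, (j <= i)%N -> a (n + j)%N = 0) /\
    forall i', (forall j, (j <= i')%N -> a (n + j)%N = 0) -> (i' <= i)%N).

End ModularForms.

(** * Weierstrass equations
    y^2 + a1 x y + a3 y = x^3 + a2 x^2 + a4 x + a6 *)

Record weierstrass (A : Type) :=
  Weierstrass { a1 : A; a2 : A; a3 : A; a4 : A; a6 : A }.

Definition map_weierstrass (A B : Type) (g : A -> B) (W : weierstrass A) :=
  Weierstrass (g (a1 W)) (g (a2 W)) (g (a3 W)) (g (a4 W)) (g (a6 W)).

Section Invariants.
Variables (A : comNzRingType) (W : weierstrass A).

Definition b2 : A := a1 W ^+ 2 + 4 * a2 W.
Definition b4 : A := 2 * a4 W + a1 W * a3 W.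
Definition b6 : A := a3 W ^+ 2 + 4 * a6 W.
Definition b8 : A :=
  a1 W ^+ 2 * a6 W + 4 * a2 W * a6 W - a1 W * a3 W * a4 W
  + a2 W * a3 W ^+ 2 - a4 W ^+ 2.
Definition c4 : A := b2 ^+ 2 - 24 * b4.
Definition discriminant : A :=
  - (b2 ^+ 2 * b8) - 8 * b4 ^+ 3 - 27 * b6 ^+ 2 + 9 * b2 * b4 * b6.

Definition on_affine (x y : A) : bool :=
  y ^+ 2 + a1 W * x * y + a3 W * y
  == x ^+ 3 + a2 W * x ^+ 2 + a4 W * x + a6 W.

End Invariants.

Section Points.
Variables (F : fieldType) (W : weierstrass F).

(* None is the point at infinity. *)
Definition ec_point := option (F * F).

Definition on_curve (P : ec_point) : bool :=
  if P is Some (x, y) then on_affine W x y else true.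

(* The chord and tangent law, for points on the curve. *)
Definition padd (P Q : ec_point) : ec_point :=
  match P, Q with
  | None, _ => Q
  | _, None => P
  | Some (x1, y1), Some (x2, y2) =>
    if (x1 == x2) && (y1 + y2 + a1 W * x2 + a3 W == 0) then None else
    let lambda :=
      if x1 == x2 then
        (3 * x1 ^+ 2 + 2 * a2 W * x1 + a4 W - a1 W * y1)
        / (2 * y1 + a1 W * x1 + a3 W)
      else (y2 - y1) / (x2 - x1) in
    let nu := y1 - lambda * x1 in
    let x3 := lambda ^+ 2 + a1 W * lambda - a2 W - x1 - x2 in
    Some (x3, - (lambda + a1 W) * x3 - nu - a3 W)
  end.

Definition pmuln (n : nat) (P : ec_point) : ec_point := iter n (padd P) None.

(* Homogeneous coordinates. *)
Definition proj_coord (P : ec_point) : 'I_3 -> F :=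
  if P is Some (x, y) then tnth [tuple x; y; 1] else tnth [tuple 0; 1; 0].

End Points.

(** * Isogenies over Q, seen on points over the algebraic numbers *)

Notation base_change F := (map_weierstrass (ratr : rat -> F)).

Definition form_eval (G : mpoly 3 rat) (P : ec_point algC) : algC :=
  meval (proj_coord P) (map_mpoly (ratr : rat -> algC) G).

(* A morphism defined over Q: near every point it is given by three forms of
   the same degree with rational coefficients. *)
Definition is_morphism (E E' : weierstrass rat)
    (phi : ec_point algC -> ec_point algC) :=
  forall P, on_curve (base_change algC E) P ->
    on_curve (base_change algC E') (phi P) /\
    exists (d : nat) (G : 'I_3 -> mpoly 3 rat),
      [/\ forall i, G i \is ishomog1 d mdeg,
          exists i, form_eval (G i) P != 0
        & forall Q, on_curve (base_change algC E) Q ->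
            (exists i, form_eval (G i) Q != 0) ->
            exists c : algC,
              forall i, proj_coord (phi Q) i = c * form_eval (G i) Q].

Definition is_isogeny (E E' : weierstrass rat)
    (phi : ec_point algC -> ec_point algC) :=
  [/\ is_morphism E E' phi, phi None = None
    & exists2 P, on_curve (base_change algC E) P & phi P <> None].

Definition has_cyclic_rational_4_isogeny (E : weierstrass rat) :=
  exists (E' : weierstrass rat) (phi : ec_point algC -> ec_point algC),
    [/\ discriminant E' != 0, is_isogeny E E' phi
      & exists g : 'Z_4 -> ec_point algC,
          [/\ injective g,
              forall P, (on_curve (base_change algC E) P /\ phi P = None)
                        <-> exists i, g i = P
            & forall i j,
                g (i + j) = padd (base_change algC E) (g i) (g j)]].

(** * Reduction and conductor *)

(* W' is obtained from W by x = u^2 x' + r, y = u^3 y' + s u^2 x' + t. *)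
Definition change_of_variables (u r s t : rat) (W W' : weierstrass rat) :=
  [/\ u * a1 W' = a1 W + 2 * s,
      u ^+ 2 * a2 W' = a2 W - s * a1 W + 3 * r - s ^+ 2,
      u ^+ 3 * a3 W' = a3 W + r * a1 W + 2 * t,
      u ^+ 4 * a4 W' = a4 W - s * a3 W + 2 * r * a2 W - (t + r * s) * a1 W
                       + 3 * r ^+ 2 - 2 * s * t
    & u ^+ 6 * a6 W' = a6 W + r * a4 W + r ^+ 2 * a2 W + r ^+ 3 - t * a3 W
                       - t ^+ 2 - r * t * a1 W].

Definition is_integral_model (E : weierstrass rat) (W : weierstrass int) :=
  exists u r s t : rat, u != 0 /\
    change_of_variables u r s t E (map_weierstrass (intr : int -> rat) W).

Definition is_minimal_model_at (p : nat) (E : weierstrass rat)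
    (W : weierstrass int) :=
  is_integral_model E W /\
  forall W', is_integral_model E W' ->
    (logn p `|discriminant W|%N <= logn p `|discriminant W'|%N)%N.

(* Trace of Frobenius p + 1 - #W(F_p), the point at infinity and a singular
   point, if any, being counted: at a bad prime of a minimal model this is
   0, 1 or -1, as in the Euler factor of the L-function. *)
Definition frobenius_trace (p : nat) (W : weierstrass int) : int :=
  (p + 1)%N%:Z -
  (#|[set u : 'F_p * 'F_p |
       on_affine (map_weierstrass (intr : int -> 'F_p) W) u.1 u.2]%SET|
   + 1)%N%:Z.

Section Wild.
Variables (L : splittingFieldType rat) (P : set L).

(* i-th ramification group of P in Gal(L / Q), in the lower numbering; for
   i >= 0 it is that of the completion of L at P. *)
Definition ramification_group (i : nat) : {set gal_of {:L}} :=
  [set g in 'Gal({:L} / 1)%g |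
    `[< forall x, ring_of_integers setT x ->
          ideal_exp (ring_of_integers setT) P i.+1 (g x - x) >]]%SET.

Definition gal_point (g : gal_of {:L}) (T : ec_point L) : ec_point L :=
  omap (fun u : L * L => (g u.1, g u.2)) T.

Definition affine_coords (tors : seq (ec_point L)) : seq L :=
  flatten [seq (if T is Some u then [:: u.1; u.2] else [::]) | T <- tors].

(* For tors = E[l]: dimension over F_l of E[l] / E[l]^(G_i). *)
Definition moved_dim (l : nat) (tors : seq (ec_point L)) (i : nat) : nat :=
  (2 - logn l (count (fun T =>
         [forall g in ramification_group i, gal_point g T == T]) tors))%N.

End Wild.

(* delta = \sum_(i >= 1) #G_i / #G_0 dim (E[l] / E[l]^(G_i)), where l != p is
   prime and G_i are the ramification groups at a prime P above p of
   L = Q(E[l]).  The value does not depend on l, L and P; the sum stops at any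
   n with G_n trivial. *)
Definition is_wild_exponent (p : nat) (E : weierstrass rat) (delta : nat) :=
  exists (l : nat) (L : splittingFieldType rat) (tors : seq (ec_point L))
         (P : set L) (n : nat),
    [/\ prime l /\ l != p,
        [/\ uniq tors, size tors = (l ^ 2)%N,
            forall T, T \in tors <->
              on_curve (base_change L E) T /\
              pmuln (base_change L E) l T = None
          & <<1 & affine_coords tors>>%VS = fullv],
        is_prime_ideal (ring_of_integers setT) P /\ lies_above P p,
        ramification_group P n = 1%g
      & (#|ramification_group P 0| * delta =
         \sum_(1 <= i < n) #|ramification_group P i| * moved_dim P l tors i)%N].

(* Exponent of the conductor at p: 0, 1 or 2 + delta according to whether the
   reduction is good, multiplicative or additive. *)
Definition is_conductor_exponent (p : nat) (E : weierstrass rat) (n : nat) :=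
  exists2 W, is_minimal_model_at p E W &
    if ~~ (p %| `|discriminant W|)%N then n = 0%N
    else if ~~ (p %| `|c4 W|)%N then n = 1%N
    else exists2 delta, is_wild_exponent p E delta & n = (2 + delta)%N.

Definition is_conductor (E : weierstrass rat) (N : nat) :=
  (0 < N)%N /\ forall p, prime p -> is_conductor_exponent p E (logn p N).

(* (f, a) is the form of level NE attached to E by modularity: a normalized
   cuspidal eigenform of weight 2 with a p = a_p(E) for all primes p. *)
Definition is_modular_form_of (R : realType) (E : weierstrass rat) (NE : nat)
    (f : R[i] -> R[i]) (a : nat -> R[i]) :=
  is_normalized_cuspidal_eigenform 2 NE f a /\
  forall p, prime p ->
    exists2 W, is_minimal_model_at p E W & a p = (frobenius_trace p W)%:~R.

(* Main.v *)
Require Import Defs.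
From HB Require Import structures.
From mathcomp Require Import all_boot all_order all_algebra all_fingroup all_field.
From mathcomp Require Import all_classical all_reals all_analysis.
From mathcomp.real_closed Require Import complex.
From mathcomp Require Import cyclic ring lra zify.
From mathcomp.multinomials Require mpoly.
Import -(notations) mpoly.

Set Implicit Arguments.
Unset Strict Implicit.
Unset Printing Implicit Defensive.

Import Order.TTheory GRing.Theory Num.Theory numFieldNormedType.Exports.

Local Open Scope classical_set_scope.
Local Open Scope ring_scope.
Local Open Scope complex_scope.

(** A sum of two squares coprime to M := lcm(N, M_f) N_E and to 2 has a non-zero
    coefficient in f, and such sums of two squares leave gaps of size O(n^(1/4)).

    Coefficients.  Comparing Fourier coefficients in T_n f = lambda f gives
    a(m n) = a(m) a(n) for coprime m and n, and
    a(p) a(p^(r+1)) = a(p^(r+2)) + p^(w-1) a(p^r) for p not dividing N, where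
    w is the weight ([eigenform_coprimeM], [eigenform_prime_recurrence]).  So
    a(n) <> 0 as soon as a(p^v) <> 0 for every p^v exactly dividing n
    ([multiplicative_neq0]).
    When p = 3 mod 4, the exponent of p in a sum of two squares is even
    ([logn_sum_squares]), and a(p^(2r)) <> 0: either a(p) <> 0 and the property
    of M_f applies, or a(p) = 0 and the recurrence gives
    a(p^(2r)) = (- p^(w-1))^r ([eigenform_even_prime_power]).
    When p = 1 mod 4, the property of M_f reduces the claim to a(p) <> 0, and
    this is where E enters.

    The elliptic curve.  Let P generate the kernel of the cyclic 4-isogeny and
    T = 2P.  The kernel is stable under the automorphisms of the algebraic
    numbers, so they fix T and map P to P or - P: the abscissas of T and P are
    rational ([cyclic4_rational_x]).  With T moved to the origin, this gives a
    model y^2 = x (x^2 + A x + s^2) with integers A and s, where s comes from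
    the abscissa of P.  At a good odd prime, x |-> s^2 / x and y |-> - y act on
    the points of this curve over F_p, and counting orbits yields 4 | #E(F_p)
    ([four_dvd_card_points]): the orbits with fewer than four elements
    contribute 2 each, and their number is even because the quadratic
    characters of A + 2s, A - 2s and A^2 - 4s^2 multiply to 1.
    Hence a_E(p) = p + 1 mod 4, which is 2 mod 4 if p = 1 mod 4
    ([frobenius_trace_2mod4]).  If a(p) were 0, then a_E(p), which is 2 times an
    odd integer, would lie in q^m, contained in q^(e+1); as 4 lies in q^(e+1),
    so would 2, against the definition of e ([two_mod4_notin_ideal_exp]).

    Gaps.  Put L = 2M, take the largest x = 1 mod L with x^2 <= n, and then the
    smallest multiple y of L with x^2 + y^2 >= n.  Then x^2 + y^2 = 1 mod L, and
    n - x^2 = O(sqrt n) forces x^2 + y^2 - n = O(n^(1/4))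
    ([sum_squares_near], [le_fourth_root]). *)

(** * Rational abscissas in the kernel of a cyclic 4-isogeny *)

(** The conjugates of x generate a Galois extension of the rationals, and each of
    its automorphisms extends to the algebraic numbers; so x lies in the fixed
    field of the whole Galois group. *)
Lemma algC_rational_of_fixed (x : algC) :
  (forall nu : {rmorphism algC -> algC}, nu x = x) -> exists r : rat, x = ratr r.
Proof.
move=> fix_x.
have [q [Dq mon_q] dv_q] := minCpolyP x.
have [rs Drs] := closed_field_poly_normal (minCpoly x).
rewrite Dq lead_coef_map (monicP mon_q) rmorph1 scale1r in Drs.
have [Qn [QnC [rs1 Drs1 genQn]]] := num_field_exists rs.
have Dq1 : map_poly (in_alg Qn) q = \prod_(z <- rs1) ('X - z%:P).
  apply: (map_inj_poly (fmorph_inj QnC) (rmorph0 QnC)).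
  rewrite -map_poly_comp rmorph_prod /= (eq_map_poly (g := ratr)); last first.
    by move=> r /=; rewrite alg_num_field fmorph_rat.
  rewrite Drs -Drs1 big_map; apply: eq_bigr => z _.
  by rewrite /= map_polyXsubC.
have Qn_ax : FieldExt_isSplittingField _ Qn.
  constructor; exists (map_poly (in_alg Qn) q); first exact: alg_polyOver.
  by exists rs1; rewrite // Dq1 eqpxx.
pose L : splittingFieldType rat := HB.pack_for (splittingFieldType rat) Qn Qn_ax.
have galL : galois 1 {:L}.
  apply/and3P; split; [exact: sub1v | | exact: normalFieldf].
  apply/separableP => z _; apply: pcharf0_separable => p.
  by rewrite pchar_lalg pchar_num.
have rs_x : x \in rs by rewrite -root_prod_XsubC -Drs -Dq root_minCpoly.
rewrite -Drs1 in rs_x; have /mapP[y _ Dx] := rs_x.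
suff /vlineP[r Dr] : y \in (1%VS : {vspace L}).
  by exists r; rewrite Dx Dr alg_num_field fmorph_rat.
have /galois_fixedField <- := galL.
apply/fixedFieldP; first exact: memvf.
move=> g _.
have [nu Dnu] := extend_algC_subfield_aut QnC (g : {rmorphism L -> L}).
by apply: (fmorph_inj QnC); rewrite Dnu -Dx fix_x.
Qed.

Section PointMap.
Variables (F F' : fieldType) (nu : {rmorphism F -> F'}).

Definition map_point (P : ec_point F) : ec_point F' :=
  omap (fun u => (nu u.1, nu u.2)) P.

Lemma on_curve_map (W : weierstrass F) P :
  on_curve W P -> on_curve (map_weierstrass nu W) (map_point P).
Proof.
case: P => [[x y]|] //=; rewrite /on_affine /= => /eqP /(congr1 nu).
by rewrite !(rmorphD, rmorphM, rmorphXn) /= => ->.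
Qed.

Lemma padd_map (W : weierstrass F) P Q :
  padd (map_weierstrass nu W) (map_point P) (map_point Q) =
  map_point (padd W P Q).
Proof.
case: P Q => [[x1 y1]|] [[x2 y2]|] //=.
rewrite -!rmorphM -!rmorphD fmorph_eq0 (inj_eq (fmorph_inj nu)).
case: ifP => // _.
case: ifP => _ /=;
  by rewrite !(rmorph_nat, rmorphXn, rmorphB, rmorphN, rmorphD, rmorphM, fmorphV).
Qed.

Lemma proj_coord_map P i : proj_coord (map_point P) i = nu (proj_coord P i).
Proof.
by case: P => [[x y]|]; case: i => [[|[|[|]]] ?] //=;
   rewrite /= !(tnth_nth 0) /= ?rmorph0 ?rmorph1.
Qed.

End PointMap.

Lemma base_change_aut (nu : {rmorphism algC -> algC}) (E : weierstrass rat) :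
  map_weierstrass nu (base_change algC E) = base_change algC E.
Proof. by case: E => *; rewrite /map_weierstrass /= !fmorph_rat. Qed.

Lemma form_eval_aut (nu : {rmorphism algC -> algC}) (G : mpoly 3 rat) P :
  form_eval G (map_point nu P) = nu (form_eval G P).
Proof.
rewrite /form_eval /meval /mmap /= rmorph_sum /=; apply: eq_bigr => m _.
rewrite rmorphM /= !mcoeff_map_mpoly fmorph_rat; congr (_ * _).
rewrite /mmap1 rmorph_prod /=; apply: eq_bigr => i _.
by rewrite rmorphXn /= proj_coord_map.
Qed.

(** The equation phi P = infinity says that, of the three forms defining phi near
    P, the third vanishes at P.  As these forms have rational coefficients, the
    condition is preserved by automorphisms. *)
Lemma isogeny_kernel_aut E E' phi (nu : {rmorphism algC -> algC}) P :
  is_isogeny E E' phi ->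
  on_curve (base_change algC E) P -> phi P = None ->
  phi (map_point nu P) = None.
Proof.
move=> [morph _ _] EP phiP.
have [_ [d [G [_ [i0 Gi0] HG]]]] := morph P EP.
have G2 : form_eval (G (lift ord0 (lift ord0 ord0))) P = 0.
  have [|c Hc] := HG P EP; first by exists i0.
  have cN0 : c != 0.
    apply/eqP => c0; have := Hc (lift ord0 ord0).
    by rewrite phiP c0 mul0r /= (tnth_nth 0) /= => /eqP; rewrite oner_eq0.
  have := Hc (lift ord0 (lift ord0 ord0)).
  rewrite phiP /= (tnth_nth 0) /= => /esym/eqP.
  by rewrite mulf_eq0 (negPf cN0) => /eqP.
have [||c Hc] := HG (map_point nu P).
- by rewrite -(base_change_aut nu); exact: on_curve_map.
- by exists i0; rewrite form_eval_aut fmorph_eq0.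
have := Hc (lift ord0 (lift ord0 ord0)).
rewrite form_eval_aut G2 rmorph0 mulr0.
case: (phi _) => [[x y]|] //=; rewrite (tnth_nth 0) /= => /eqP.
by rewrite oner_eq0.
Qed.

(** The cubic on the right of (2y + a1 x + a3)^2 = 4x^3 + b2 x^2 + 2 b4 x + b6;
    its roots are the abscissas of the points of order 2. *)
Definition two_torsion_cubic (F : comNzRingType) (W : weierstrass F) (x : F) : F :=
  4 * x ^+ 3 + b2 W * x ^+ 2 + 2 * b4 W * x + b6 W.

Definition two_torsion_cubic_deriv (F : comNzRingType) (W : weierstrass F)
    (x : F) : F :=
  12 * x ^+ 2 + 2 * b2 W * x + 2 * b4 W.

Lemma two_torsion_cubic_on_affine (F : comNzRingType) (W : weierstrass F) x y :
  on_affine W x y -> (2 * y + a1 W * x + a3 W) ^+ 2 = two_torsion_cubic W x.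
Proof.
move=> /eqP H; rewrite /two_torsion_cubic /b2 /b4 /b6.
have -> : (2 * y + a1 W * x + a3 W) ^+ 2 =
  4 * (y ^+ 2 + a1 W * x * y + a3 W * y) + (a1 W * x + a3 W) ^+ 2 by ring.
by rewrite H; ring.
Qed.

(** With u the abscissa shifted so that the 2-torsion point is at u = 0, the
    curve reads Y^2 = 4u (u^2 + A u + B) and the duplication formula is
    u(2P) = (u^2 - B)^2 / Y^2.  So 2P is the 2-torsion point exactly when
    u^2 = B, and 4B is the derivative of the cubic there. *)
Lemma double_eq_2torsion (F : fieldType) (W : weierstrass F) x y t z :
  2 != 0 :> F ->
  on_affine W x y -> on_affine W t z ->
  padd W (Some (t, z)) (Some (t, z)) = None ->
  padd W (Some (x, y)) (Some (x, y)) = Some (t, z) ->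
  two_torsion_cubic W t = 0 /\ 4 * (x - t) ^+ 2 = two_torsion_cubic_deriv W t.
Proof.
move=> n2 Hxy Htz; rewrite /= !eqxx /=.
case: eqP => // Ht _; case: eqP => //= /eqP Hy [Dt _].
have Et : two_torsion_cubic W t = 0.
  rewrite -(two_torsion_cubic_on_affine Htz) (_ : _ + _ + _ = 0) ?expr0n //.
  by rewrite -[RHS]Ht; ring.
split=> //.
have Ey := two_torsion_cubic_on_affine Hxy.
pose Y := 2 * y + a1 W * x + a3 W.
have YN0 : Y != 0 by apply: contra Hy => /eqP <-; rewrite /Y; apply/eqP; ring.
have n4 : 4 != 0 :> F by rewrite (_ : 4 = 2 * 2) ?mulf_neq0 //; ring.
have Ft : (6 * x ^+ 2 + b2 W * x + b4 W) ^+ 2 =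
          (4 * t + b2 W + 8 * x) * two_torsion_cubic W x.
  rewrite -Ey -/Y.
  set l := (X in X ^+ 2 + _ * X) in Dt.
  have El : l * Y = 3 * x ^+ 2 + 2 * a2 W * x + a4 W - a1 W * y.
    by rewrite /l divfK.
  have -> : 4 * t + b2 W + 8 * x = (2 * l + a1 W) ^+ 2.
    by rewrite -Dt /b2; ring.
  have <- : (2 * l + a1 W) * Y = 6 * x ^+ 2 + b2 W * x + b4 W.
    have -> : (2 * l + a1 W) * Y = 2 * (l * Y) + a1 W * Y by ring.
    by rewrite El /Y /b2 /b4; ring.
  by rewrite exprMn.
apply/eqP; rewrite -subr_eq0; apply/eqP.
have : (4 * (x - t) ^+ 2 - two_torsion_cubic_deriv W t) ^+ 2 / 4 = 0.
  have -> : (4 * (x - t) ^+ 2 - two_torsion_cubic_deriv W t) ^+ 2 / 4 =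
    (6 * x ^+ 2 + b2 W * x + b4 W) ^+ 2
    - (4 * t + b2 W + 8 * x) * (two_torsion_cubic W x - two_torsion_cubic W t).
    by rewrite /two_torsion_cubic /two_torsion_cubic_deriv; field.
  by rewrite Ft Et subr0 subrr.
by move/eqP; rewrite mulf_eq0 expf_eq0 invr_eq0 (negPf n4) orbF /= => /eqP.
Qed.

(** An automorphism permutes the kernel and commutes with the group law.  Hence
    it fixes the only element T of order 2, and sends a generator P to P or
    - P, which have the same abscissa.  Here t is the abscissa of T, and v is
    the difference of those of P and T. *)
Lemma cyclic4_rational_x E :
  has_cyclic_rational_4_isogeny E ->
  exists t v : rat,
    two_torsion_cubic E t = 0 /\ 4 * v ^+ 2 = two_torsion_cubic_deriv E t.
Proof.
move=> [E' [phi [_ phi_isog [g [g_inj kerP gD]]]]].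
set EC := base_change algC E in kerP gD.
have phi0 : phi None = None by case: phi_isog.
have [i0 gi0] : exists i, g i = None by apply/kerP.
have g0 : g 0 = None.
  rewrite -gi0; congr g; apply: (addrI i0); apply: g_inj.
  by rewrite addr0 gD gi0.
have gK i : on_curve EC (g i) /\ phi (g i) = None by apply/kerP; exists i.
have g11 : padd EC (g 1) (g 1) = g (1 + 1) by rewrite gD.
have g22 : padd EC (g (1 + 1)) (g (1 + 1)) = None.
  by rewrite -gD -g0; congr g; apply: val_inj.
have gN0 i : i != 0 -> exists x y, g i = Some (x, y).
  move=> iN0; case Dg: (g i) => [[x y]|]; first by exists x, y.
  by case/eqP: iN0; apply: g_inj; rewrite Dg g0.
have [t [z DT]] := gN0 (1 + 1) isT.
have [x [y DP]] := gN0 1 isT.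
have aut_g (nu : {rmorphism algC -> algC}) i : exists j, map_point nu (g i) = g j.
  have [Ei phii] := gK i.
  have [j <-] : exists j, g j = map_point nu (g i).
    apply/kerP; split; last exact: isogeny_kernel_aut phi_isog Ei phii.
    by rewrite /EC -(base_change_aut nu); exact: on_curve_map.
  by exists j.
have aut_D (nu : {rmorphism algC -> algC}) P Q :
    padd EC (map_point nu P) (map_point nu Q) = map_point nu (padd EC P Q).
  by rewrite -padd_map /EC base_change_aut.
have Z4 (i : 'Z_4) : i + i = 0 -> i = 0 \/ i = 1 + 1.
  by case: i => [[|[|[|[|]]]] // ?] H; [left | right]; apply: val_inj.
have Z4' (i : 'Z_4) : i + i = 1 + 1 -> i = 1 \/ i = 1 + 1 + 1.
  by case: i => [[|[|[|[|]]]] // ?] H; [left | right]; apply: val_inj.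
have aut_T (nu : {rmorphism algC -> algC}) : map_point nu (g (1 + 1)) = g (1 + 1).
  have [j Dj] := aut_g nu (1 + 1).
  have /Z4 [j0|j2] : j + j = 0.
    by apply: g_inj; rewrite gD -Dj aut_D g22 g0.
  - by move: Dj; rewrite DT j0 g0.
  - by rewrite Dj j2.
have Et (nu : {rmorphism algC -> algC}) : nu t = t by have := aut_T nu; rewrite DT => -[].
have Ex (nu : {rmorphism algC -> algC}) : nu x = x.
  have [j Dj] := aut_g nu 1.
  have /Z4' [j1|j3] : j + j = 1 + 1.
  - by apply: g_inj; rewrite gD -Dj aut_D g11 aut_T.
  - by move: Dj; rewrite j1 DP => -[].
  have : padd EC (g 1) (g (1 + 1 + 1)) = None.
    by rewrite -gD -g0; congr g; apply: val_inj.
  by rewrite -j3 -Dj DP /=; case: eqP.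
have [[rt Drt] [rx Drx]] := (algC_rational_of_fixed Et, algC_rational_of_fixed Ex).
have [|||||H1 H2] := @double_eq_2torsion _ EC x y t z.
- by rewrite pnatr_eq0.
- by have [] := gK 1; rewrite DP.
- by have [] := gK (1 + 1); rewrite DT.
- by rewrite -DT.
- by rewrite -DP -DT.
have cubic_ratr r :
    ratr (two_torsion_cubic E r) = two_torsion_cubic EC (ratr r) :> algC.
  rewrite /two_torsion_cubic /b2 /b4 /b6 /=.
  by rewrite !(rmorph_nat, rmorphXn, rmorphD, rmorphM).
have cubic_deriv_ratr r :
    ratr (two_torsion_cubic_deriv E r) =
    two_torsion_cubic_deriv EC (ratr r) :> algC.
  rewrite /two_torsion_cubic_deriv /b2 /b4 /b6 /=.
  by rewrite !(rmorph_nat, rmorphXn, rmorphD, rmorphM).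
exists rt, (rx - rt); split; apply: (fmorph_inj (ratr : rat -> algC)).
  by rewrite /= rmorph0 cubic_ratr -Drt.
rewrite /= cubic_deriv_ratr -Drt -H2 Drx Drt.
by rewrite !(rmorph_nat, rmorphXn, rmorphB, rmorphM).
Qed.

(** * Integral models with a rational point of order 2 *)

(** The change of variables acts on abscissas by x = u^2 x' + r; it divides the
    cubic by u^6 and its derivative by u^4. *)
Lemma change_of_variables_two_torsion (E W : weierstrass rat) u r s t x v :
  u != 0 -> change_of_variables u r s t E W ->
  two_torsion_cubic E x = 0 -> 4 * v ^+ 2 = two_torsion_cubic_deriv E x ->
  two_torsion_cubic W ((x - r) / u ^+ 2) = 0 /\
  4 * (v / u ^+ 2) ^+ 2 = two_torsion_cubic_deriv W ((x - r) / u ^+ 2).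
Proof.
move=> uN0 [E1 E2 E3 E4 E6] Hx Hv.
have B2 : b2 W = (b2 E + 12 * r) / u ^+ 2.
  apply: (mulIf (expf_neq0 2 uN0)); rewrite divfK ?expf_neq0 //.
  have -> : b2 W * u ^+ 2 = (u * a1 W) ^+ 2 + 4 * (u ^+ 2 * a2 W).
    by rewrite /b2; ring.
  by rewrite E1 E2 /b2; ring.
have B4 : b4 W = (b4 E + r * b2 E + 6 * r ^+ 2) / u ^+ 4.
  apply: (mulIf (expf_neq0 4 uN0)); rewrite divfK ?expf_neq0 //.
  have -> : b4 W * u ^+ 4 =
    2 * (u ^+ 4 * a4 W) + (u * a1 W) * (u ^+ 3 * a3 W) by rewrite /b4; ring.
  by rewrite E1 E3 E4 /b2 /b4; ring.
have B6 : b6 W = (b6 E + 2 * r * b4 E + r ^+ 2 * b2 E + 4 * r ^+ 3) / u ^+ 6.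
  apply: (mulIf (expf_neq0 6 uN0)); rewrite divfK ?expf_neq0 //.
  have -> : b6 W * u ^+ 6 = (u ^+ 3 * a3 W) ^+ 2 + 4 * (u ^+ 6 * a6 W).
    by rewrite /b6; ring.
  by rewrite E3 E6 /b2 /b4 /b6; ring.
split.
  have -> : two_torsion_cubic W ((x - r) / u ^+ 2) = two_torsion_cubic E x / u ^+ 6.
    by rewrite /two_torsion_cubic B2 B4 B6; field.
  by rewrite Hx mul0r.
have -> : two_torsion_cubic_deriv W ((x - r) / u ^+ 2) =
    two_torsion_cubic_deriv E x / u ^+ 4.
  by rewrite /two_torsion_cubic_deriv B2 B4; field.
by rewrite -Hv; field.
Qed.

Lemma change_of_variables_discriminant (E W : weierstrass rat) u r s t :
  change_of_variables u r s t E W ->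
  u ^+ 12 * discriminant W = discriminant E.
Proof.
move=> [E1 E2 E3 E4 E6].
have B2 : u ^+ 2 * b2 W = b2 E + 12 * r.
  have -> : u ^+ 2 * b2 W = (u * a1 W) ^+ 2 + 4 * (u ^+ 2 * a2 W).
    by rewrite /b2; ring.
  by rewrite E1 E2 /b2; ring.
have B4 : u ^+ 4 * b4 W = b4 E + r * b2 E + 6 * r ^+ 2.
  have -> : u ^+ 4 * b4 W =
    2 * (u ^+ 4 * a4 W) + (u * a1 W) * (u ^+ 3 * a3 W) by rewrite /b4; ring.
  by rewrite E1 E3 E4 /b2 /b4; ring.
have B6 : u ^+ 6 * b6 W = b6 E + 2 * r * b4 E + r ^+ 2 * b2 E + 4 * r ^+ 3.
  have -> : u ^+ 6 * b6 W = (u ^+ 3 * a3 W) ^+ 2 + 4 * (u ^+ 6 * a6 W).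
    by rewrite /b6; ring.
  by rewrite E3 E6 /b2 /b4 /b6; ring.
have b8E (V : weierstrass rat) : b8 V = (b2 V * b6 V - b4 V ^+ 2) / 4.
  by rewrite /b8 /b2 /b4 /b6; field.
have -> : u ^+ 12 * discriminant W =
    - ((u ^+ 2 * b2 W) ^+ 2 *
       (((u ^+ 2 * b2 W) * (u ^+ 6 * b6 W) - (u ^+ 4 * b4 W) ^+ 2) / 4))
    - 8 * (u ^+ 4 * b4 W) ^+ 3 - 27 * (u ^+ 6 * b6 W) ^+ 2
    + 9 * (u ^+ 2 * b2 W) * (u ^+ 4 * b4 W) * (u ^+ 6 * b6 W).
  by rewrite /discriminant b8E; field.
by rewrite B2 B4 B6 /discriminant b8E; field.
Qed.

(** Algebraic integers that are rational are integers. *)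
Lemma rat_int_of_monic_root (P : {poly int}) (x : rat) :
  P \is monic -> root (map_poly intr P) x -> exists z : int, x = z%:~R.
Proof.
move=> monP rx.
have xA : (ratr x : algC) \in Aint.
  apply: (@root_monic_Aint (map_poly intr P)).
  - rewrite -(fmorph_root (ratr : rat -> algC)) -map_poly_comp in rx.
    have <- // : map_poly (ratr \o intr) P = map_poly intr P :> {poly algC}.
    by apply: eq_map_poly => z /=; rewrite rmorph_int.
  - exact: monic_map.
  - by apply/polyOverP => i; rewrite coef_map /= intr_int.
have /intrP[z Dz] := Cint_rat_Aint (Crat_rat _) xA.
by exists z; apply: (fmorph_inj (ratr : rat -> algC)); rewrite /= Dz rmorph_int.
Qed.

Lemma rat_int_of_monic_cubic (k2 k1 k0 : int) (x : rat) :
  x ^+ 3 + k2%:~R * x ^+ 2 + k1%:~R * x + k0%:~R = 0 ->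
  exists z : int, x = z%:~R.
Proof.
move=> Hx; pose P : {poly int} := 'X^3 + (k2 *: 'X^2 + (k1 *: 'X + k0%:P)).
apply: (@rat_int_of_monic_root P).
  rewrite monicE lead_coefDl ?lead_coefXn // size_polyXn.
  apply: leq_ltn_trans (size_polyD _ _) _; rewrite gtn_max.
  rewrite (leq_ltn_trans (size_scale_leq _ _)) ?size_polyXn //=.
  apply: leq_ltn_trans (size_polyD _ _) _; rewrite gtn_max.
  rewrite (leq_ltn_trans (size_scale_leq _ _)) ?size_polyX //=.
  by rewrite (leq_ltn_trans (size_polyC_leq1 _)).
rewrite /root /P !rmorphD /= !map_polyZ /= !map_polyXn map_polyX map_polyC /=.
by rewrite !hornerE /= -mulrA -expr2 Hx.
Qed.

(** The substitution X = 4x makes the cubic monic with integral coefficients, so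
    c = 4t is an integer; then s = 4v is an integer because its square is. *)
Lemma integral_two_torsion (W : weierstrass int) (t v : rat) :
  let WQ := map_weierstrass (intr : int -> rat) W in
  two_torsion_cubic WQ t = 0 -> 4 * v ^+ 2 = two_torsion_cubic_deriv WQ t ->
  exists c s : int,
    c ^+ 3 + b2 W * c ^+ 2 + 8 * b4 W * c + 16 * b6 W = 0 /\
    s ^+ 2 = 3 * c ^+ 2 + 2 * b2 W * c + 8 * b4 W.
Proof.
move=> WQ Ht Hv.
have b2E : b2 WQ = (b2 W)%:~R by rewrite /b2 /= rmorphD !rmorphM.
have b4E : b4 WQ = (b4 W)%:~R by rewrite /b4 /= rmorphD !rmorphM.
have b6E : b6 WQ = (b6 W)%:~R by rewrite /b6 /= rmorphD !rmorphM.
have [c Dc] : exists c : int, 4 * t = c%:~R.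
  apply: (@rat_int_of_monic_cubic (b2 W) (8 * b4 W) (16 * b6 W)).
  rewrite !rmorphM /= -b2E -b4E -b6E.
  transitivity (16 * two_torsion_cubic WQ t); last by rewrite Ht mulr0.
  by rewrite /two_torsion_cubic; ring.
have [s Ds] : exists s : int, 4 * v = s%:~R.
  pose z : int := 3 * c ^+ 2 + 2 * b2 W * c + 8 * b4 W.
  apply: (@rat_int_of_monic_root ('X^2 - z%:P)).
    by rewrite monicXnsubC.
  rewrite /root rmorphB /= map_polyXn map_polyC /= !hornerE /=.
  have -> : (4 * v) ^+ 2 = 4 * (4 * v ^+ 2) by ring.
  rewrite Hv /z /two_torsion_cubic_deriv /b2 /b4 /=.
  rewrite !(rmorph_nat, rmorphXn, rmorphD, rmorphM) /= -Dc.
  by apply/eqP; ring.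
exists c, s; split; apply: (intr_inj (R := rat)).
  transitivity (16 * two_torsion_cubic WQ t); last by rewrite Ht mulr0.
  rewrite /two_torsion_cubic /b2 /b4 /b6 /=.
  by rewrite !(rmorph_nat, rmorphXn, rmorphD, rmorphM) /= -Dc; ring.
rewrite rmorphXn /= -Ds.
have -> : (4 * v) ^+ 2 = 4 * (4 * v ^+ 2) by ring.
rewrite Hv /two_torsion_cubic_deriv /b2 /b4 /=.
by rewrite !(rmorph_nat, rmorphXn, rmorphD, rmorphM) /= -Dc; ring.
Qed.

(** * Points modulo 4 over finite fields *)

Lemma even_card_free_involution (T : finType) (A : {set T}) (f : T -> T) :
  {in A, forall x, f x \in A /\ f x != x /\ f (f x) = x} -> ~~ odd #|A|.
Proof.
have [n] := ubnP #|A|; elim: n A => // n IHn A leAn Hf.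
have [->|[x Ax]] := set_0Vmem A; first by rewrite cards0.
have [Afx [fxN ffx]] := Hf x Ax.
have Afx' : f x \in A :\ x by rewrite !inE fxN.
have EA : #|A| = #|A :\ x :\ f x|.+2.
  by rewrite (cardsD1 x) Ax (cardsD1 (f x)) Afx'.
rewrite EA /= negbK; apply: IHn; first by rewrite EA in leAn; lia.
move=> y; rewrite !inE => /and3P[yfx yx Ay].
have [Afy [fyN ffy]] := Hf y Ay; rewrite Afy fyN ffy.
split=> //; rewrite andbT; apply/andP; split.
  by apply: contra yx => /eqP E; rewrite -ffy E ffx.
by apply: contra yfx => /eqP E; rewrite -ffy E.
Qed.

Section SquareRoots.
Variable F : finFieldType.
Hypothesis n2 : 2 != 0 :> F.
Implicit Types a b x y : F.

Definition nsqrt a : nat := #|[set y : F | y ^+ 2 == a]%SET|.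
Definition is_square a : bool := [exists y : F, y ^+ 2 == a].

Lemma nsqrt0 : nsqrt 0 = 1%N.
Proof.
rewrite /nsqrt (_ : finset _ = [set 0]%SET) ?cards1 //.
by apply/setP => y; rewrite !inE expf_eq0.
Qed.

Lemma oppr_neq y : y != 0 -> - y != y.
Proof.
move=> yN0; rewrite -subr_eq0 -opprD oppr_eq0.
by rewrite (_ : y + y = 2 * y) ?mulf_neq0 //; ring.
Qed.

Lemma nsqrtE a : a != 0 -> nsqrt a = (2 * is_square a)%N.
Proof.
move=> aN0; rewrite /nsqrt /is_square; case: existsP => [[y /eqP Dy]|noy].
  have yN0 : y != 0 by apply: contra aN0 => /eqP y0; rewrite -Dy y0 expr0n.
  rewrite (_ : finset _ = [set y; - y]%SET); last first.
    by apply/setP => z; rewrite !inE -Dy eqf_sqr.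
  by rewrite cards2 eq_sym oppr_neq.
rewrite (_ : finset _ = finset.set0) ?cards0 //.
by apply/setP => y; rewrite !inE; apply/negbTE/negP => Dy; apply: noy; exists y.
Qed.

(** The unit group is cyclic, so squares are the even powers of a generator. *)
Lemma is_squareM a b : a != 0 -> b != 0 ->
  is_square (a * b) = (is_square a == is_square b).
Proof.
have [g gen] : exists g : F, forall x, x != 0 -> exists i, x = g ^+ i.
  have /cyclicP[g Dg] := field_unit_group_cyclic [set: {unit F}]%G.
  exists (val g) => x xN0; have xU : x \is a GRing.unit by rewrite unitfE.
  have : FinRing.unit F xU \in [set: {unit F}]%SET by rewrite inE.
  rewrite /= Dg => /cycleP[i Di]; exists i.
  by rewrite -[LHS]/(val (FinRing.unit F xU)) Di FinRing.val_unitX.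
have sqV x y : x != 0 -> is_square x -> is_square (x * y) = is_square y.
  move=> xN0 /existsP[z /eqP Dz].
  have zN0 : z != 0 by apply: contra xN0 => /eqP z0; rewrite -Dz z0 expr0n.
  apply/existsP/existsP => -[w /eqP Dw].
    by exists (w / z); rewrite expr_div_n Dw Dz mulrAC divff ?mul1r.
  by exists (z * w); rewrite exprMn Dz Dw.
move=> aN0 bN0; case: (boolP (is_square a)) => sa; first by rewrite sqV.
case: (boolP (is_square b)) => sb; first by rewrite mulrC sqV // (negbTE sa).
have oddexp i : ~~ is_square (g ^+ i) -> odd i.
  apply: contraR => ei; apply/existsP; exists (g ^+ i./2).
  by rewrite -exprM muln2 halfK (negbTE ei) subn0.
have [[i Di] [j Dj]] := (gen a aN0, gen b bN0).
apply/existsP; exists (g ^+ (i + j)./2).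
rewrite -exprM muln2 halfK oddD.
by rewrite !oddexp -?Di -?Dj //= subn0 exprD -Di -Dj.
Qed.

Lemma nsqrt_scale z a : z != 0 -> nsqrt (z ^+ 2 * a) = nsqrt a.
Proof.
move=> zN0; have [->|aN0] := eqVneq a 0; first by rewrite mulr0.
rewrite !nsqrtE ?mulf_neq0 ?expf_neq0 // is_squareM ?expf_neq0 //.
have -> : is_square (z ^+ 2) by apply/existsP; exists z.
by case: (is_square a).
Qed.

Variables A s : F.
Hypothesis disc_neq0 : s * (A ^+ 2 - 4 * s ^+ 2) != 0.

Let h x := x * (x ^+ 2 + A * x + s ^+ 2).

Lemma card_quadratic_roots :
  #|[set x : F | x ^+ 2 + A * x + s ^+ 2 == 0]%SET| = nsqrt (A ^+ 2 - 4 * s ^+ 2).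
Proof.
have n4 : 4 != 0 :> F by rewrite (_ : 4 = 2 * 2) ?mulf_neq0 //; ring.
have bij_f : bijective (fun x : F => 2 * x + A).
  by exists (fun y => (y - A) / 2) => x; field.
rewrite /nsqrt -[RHS](on_card_preimset (onW_bij _ bij_f)).
apply: eq_card => x; rewrite !inE -[RHS]subr_eq0.
rewrite (_ : (2 * x + A) ^+ 2 - _ = 4 * (x ^+ 2 + A * x + s ^+ 2)); last by ring.
by rewrite mulf_eq0 (negPf n4).
Qed.

(** Up to a non-zero square factor, x (x^2 + A x + s^2) is invariant under the
    involution x |-> s^2 / x, so the abscissas with two points, apart from
    s and - s, come in pairs and contribute a multiple of 4.  What remains
    is 1 for x = 0, 1 for each root of the quadratic factor, the points above
    s and - s, and the point at infinity, which is the successor in the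
    statement.  The numbers of the remaining points are governed by the
    quadratic characters of A^2 - 4s^2, A + 2s and A - 2s, and the first is
    the product of the other two. *)
Lemma four_dvd_card_points :
  (4 %| (\sum_(x : F) nsqrt (h x)).+1)%N.
Proof.
have [sN0 DN0] : s != 0 /\ A ^+ 2 - 4 * s ^+ 2 != 0.
  by move: disc_neq0; rewrite mulf_eq0 negb_or => /andP.
have [ApN0 AmN0] : A + 2 * s != 0 /\ A - 2 * s != 0.
  have : (A + 2 * s) * (A - 2 * s) != 0.
    by rewrite (_ : _ * _ = A ^+ 2 - 4 * s ^+ 2) //; ring.
  by rewrite mulf_eq0 negb_or => /andP.
have s2N0 : s ^+ 2 != 0 by rewrite expf_neq0.
have NsN : - s != s by apply: oppr_neq.
pose R := ([set x : F | x ^+ 2 + A * x + s ^+ 2 == 0])%SET.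
pose X := ([set x : F | [&& x != 0, x != s, x != - s, x \notin R & is_square (h x)]])%SET.
have h0 : h 0 = 0 by rewrite /h mul0r.
have hs : h s = s ^+ 2 * (A + 2 * s) by rewrite /h; ring.
have hNs : h (- s) = s ^+ 2 * (A - 2 * s) by rewrite /h; ring.
have RN x : x \in R -> [&& x != 0, x != s & x != - s].
  rewrite inE => Rx; apply/and3P; split; apply: contraTneq Rx => ->.
  - by rewrite expr0n mulr0 !add0r.
  - by rewrite (_ : _ + _ = s * (A + 2 * s)) ?mulf_neq0 //; ring.
  - by rewrite (_ : _ + _ = - s * (A - 2 * s)) ?mulf_neq0 ?oppr_eq0 //; ring.
have evenX : ~~ odd #|X|.
  apply: (@even_card_free_involution _ X (fun x => s ^+ 2 / x)) => x.
  rewrite !inE => /and5P[xN0 xNs xNNs xR xsq].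
  have hx : h (s ^+ 2 / x) = (s ^+ 2 / x ^+ 2) ^+ 2 * h x by rewrite /h; field.
  have xs : s ^+ 2 / x != x.
    apply: contra xNs => /eqP E.
    have : s ^+ 2 == x ^+ 2 by have := congr1 (fun z => z * x) E; rewrite /= divfK // => ->.
    by rewrite eq_sym eqf_sqr (negPf xNNs) orbF.
  split; last by split=> //; field; rewrite xN0.
  apply/and5P; split.
  - by rewrite mulf_neq0 ?invr_eq0.
  - apply: contra xNs => /eqP E; apply/eqP.
    apply: (mulfI sN0); have := congr1 (fun z => z * x) E.
    by rewrite /= divfK // expr2 => ->.
  - apply: contra xNNs => /eqP E; apply/eqP.
    apply: (mulfI sN0); have := congr1 (fun z => z * x) E.
    by rewrite /= divfK // mulrN mulNr expr2 => ->; rewrite opprK.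
  - apply: contra xR => /eqP E.
    have : (x / s) ^+ 2 * ((s ^+ 2 / x) ^+ 2 + A * (s ^+ 2 / x) + s ^+ 2) = 0.
      by rewrite E mulr0.
    by move=> <-; apply/eqP; field; rewrite xN0.
  - by rewrite hx; apply/existsP; case/existsP: xsq => y /eqP Dy;
       exists (s ^+ 2 / x ^+ 2 * y); rewrite exprMn Dy.
have Esum : (\sum_(x : F) nsqrt (h x) =
    1 + (nsqrt (A + 2 * s)%R + (nsqrt (A - 2 * s)%R + (#|R| + 2 * #|X|))))%N.
  rewrite (bigD1 0) //= h0 nsqrt0; congr (_ + _)%N.
  rewrite (bigD1 s) //= hs nsqrt_scale //; congr (_ + _)%N.
  rewrite (bigD1 (- s)) /=; last by rewrite oppr_eq0 sN0.
  rewrite hNs nsqrt_scale //; congr (_ + _)%N.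
  rewrite (bigID (mem R)) /=; congr (_ + _)%N.
    rewrite -sum1_card; apply: eq_big => x.
      case Rx: (x \in R); last by rewrite andbF.
      by have /and3P[-> -> ->] := RN x Rx.
    case/andP=> _; rewrite inE => /eqP Rx.
    by rewrite /h Rx mulr0 nsqrt0.
  rewrite -sum1_card big_distrr /= (bigID (fun x => is_square (h x))) /=.
  rewrite [X in (_ + X)%N]big1 ?addn0; last first.
    move=> x /andP[/andP[/andP[/andP[xN0 _] _] xR] nsq].
    rewrite nsqrtE ?(negPf nsq) //.
    by rewrite /h mulf_neq0 //; move: xR; rewrite inE.
  apply: eq_big => x.
    by rewrite !inE -!andbA.
  move=> /andP[/andP[/andP[/andP[xN0 _] _] xR] sq].
  rewrite nsqrtE ?sq //.
  by rewrite /h mulf_neq0 //; move: xR; rewrite inE.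
rewrite Esum card_quadratic_roots.
rewrite (_ : A ^+ 2 - 4 * s ^+ 2 = (A + 2 * s) * (A - 2 * s)); last by ring.
rewrite !nsqrtE ?mulf_neq0 // is_squareM //.
have -> : #|X| = (2 * #|X|./2)%N.
  by rewrite mul2n -[LHS](odd_double_half #|X|) (negbTE evenX).
by case: (is_square _); case: (is_square _); rewrite /= ?muln0 ?muln1; lia.
Qed.

End SquareRoots.

(** The substitution X = 4x - c, Y = 4 (2y + a1 x + a3) turns the curve into
    Y^2 = X (X^2 + A X + s^2) with A = 3c + b2. *)
Lemma card_weierstrass_points (F : finFieldType) (W : weierstrass F) (c s : F) :
  2 != 0 :> F -> discriminant W != 0 ->
  c ^+ 3 + b2 W * c ^+ 2 + 8 * b4 W * c + 16 * b6 W = 0 ->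
  s ^+ 2 = 3 * c ^+ 2 + 2 * b2 W * c + 8 * b4 W ->
  (4 %| #|[set u : F * F | on_affine W u.1 u.2]%SET| + 1)%N.
Proof.
move=> n2 DN0 Hc Hs.
have n4 : 4 != 0 :> F by rewrite (_ : 4 = 2 * 2) ?mulf_neq0 //; ring.
have n8 : 8 != 0 :> F by rewrite (_ : 8 = 2 * 4) ?mulf_neq0 //; ring.
have n16 : 16 != 0 :> F by rewrite (_ : 16 = 4 * 4) ?mulf_neq0 //; ring.
pose A := 3 * c + b2 W.
have disc : s * (A ^+ 2 - 4 * s ^+ 2) != 0.
  suff : s ^+ 4 * (A ^+ 2 - 4 * s ^+ 2) != 0.
    apply: contra => /eqP E; apply/eqP.
    transitivity (s ^+ 3 * (s * (A ^+ 2 - 4 * s ^+ 2))); first by ring.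
    by rewrite E mulr0.
  have b8E : b8 W = (b2 W * b6 W - b4 W ^+ 2) / 4.
    by rewrite /b8 /b2 /b4 /b6; field.
  have b6E : b6 W = - (c ^+ 3 + b2 W * c ^+ 2 + 8 * b4 W * c) / 16.
    by apply: (mulfI n16); rewrite mulrCA divff // mulr1;
       apply/eqP; rewrite -subr_eq0 opprK addrC Hc.
  have -> : s ^+ 4 * (A ^+ 2 - 4 * s ^+ 2) = 256 * discriminant W.
    have -> : s ^+ 4 = (s ^+ 2) ^+ 2 by rewrite -exprM.
    rewrite Hs.
    by rewrite /discriminant b8E b6E /A; field; rewrite n4 n16.
  by rewrite (_ : 256 = 16 * 16) ?mulf_neq0 //; ring.
have := four_dvd_card_points n2 disc; rewrite addn1.
set S := (\sum_x _)%N.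
suff <- : S = #|[set u : F * F | on_affine W u.1 u.2]%SET| by [].
rewrite {}/S /nsqrt.
have bij_f : bijective (fun u : F * F =>
    (4 * u.1 - c, 4 * (2 * u.2 + a1 W * u.1 + a3 W))).
  exists (fun v : F * F =>
    ((v.1 + c) / 4, (v.2 / 4 - a1 W * ((v.1 + c) / 4) - a3 W) / 2)) => -[x y] /=.
    by congr (_, _); field; rewrite ?n2 ?n4.
  by congr (_, _); field; rewrite ?n2 ?n4.
pose h (x : F) := x * (x ^+ 2 + A * x + s ^+ 2).
transitivity #|[set v : F * F | v.2 ^+ 2 == h v.1]%SET|.
  rewrite -sum1_card.
  rewrite (eq_bigl (fun v : F * F => true && (v.2 ^+ 2 == h v.1))); last first.
    by move=> v; rewrite inE.
  rewrite -(pair_big_dep xpredT (fun x y => y ^+ 2 == h x) (fun _ _ => 1%N)) /=.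
  by apply: eq_bigr => x _; rewrite -sum1_card; apply: eq_bigl => y; rewrite inE.
rewrite -[LHS](on_card_preimset (onW_bij _ bij_f)).
apply: eq_card => -[x y]; rewrite !inE /=.
rewrite -[LHS]subr_eq0 -[RHS]subr_eq0.
set P := y ^+ 2 + _ + _ - _.
rewrite (_ : _ - h _ = 64 * P).
  by rewrite mulf_eq0 (_ : 64 = 4 * 16) ?mulf_eq0 ?(negPf n4) ?(negPf n16) //; ring.
have b6E : 16 * b6 W = - (c ^+ 3 + b2 W * c ^+ 2 + 8 * b4 W * c).
  by apply/eqP; rewrite -subr_eq0 opprK addrC Hc.
have -> : 64 * P = (4 * (2 * y + a1 W * x + a3 W)) ^+ 2
  - (64 * x ^+ 3 + 16 * b2 W * x ^+ 2 + 32 * b4 W * x + 16 * b6 W).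
  by rewrite /P /b2 /b4 /b6; ring.
by rewrite b6E /h /A Hs; ring.
Qed.

Lemma Fp_intr_eq0 p (z : int) : prime p -> (z%:~R == 0 :> 'F_p) = (p %| `|z|)%N.
Proof.
move=> pr_p; rewrite (dvdn_pcharf (pchar_Fp pr_p)).
by case: z => n //; rewrite NegzE rmorphN oppr_eq0 abszN.
Qed.

Lemma frobenius_trace_mod4 p (W : weierstrass int) (c s : int) :
  prime p -> odd p -> ~~ (p %| `|discriminant W|)%N ->
  c ^+ 3 + b2 W * c ^+ 2 + 8 * b4 W * c + 16 * b6 W = 0 ->
  s ^+ 2 = 3 * c ^+ 2 + 2 * b2 W * c + 8 * b4 W ->
  exists j : int, frobenius_trace p W = (p + 1)%N%:Z + 4 * j.
Proof.
move=> pr_p odd_p ndvd Hc Hs.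
pose WF := map_weierstrass (intr : int -> 'F_p) W.
have n2 : 2 != 0 :> 'F_p.
  have := Fp_intr_eq0 2 pr_p; rewrite -pmulrn => ->.
  by rewrite dvdn_prime2 //; apply: contraL odd_p => /eqP ->.
have b2E : b2 WF = (b2 W)%:~R.
  by rewrite /b2 /= !(rmorph_nat, rmorphXn, rmorphD, rmorphM).
have b4E : b4 WF = (b4 W)%:~R.
  by rewrite /b4 /= !(rmorph_nat, rmorphXn, rmorphD, rmorphM).
have b6E : b6 WF = (b6 W)%:~R.
  by rewrite /b6 /= !(rmorph_nat, rmorphXn, rmorphD, rmorphM).
have discE : discriminant WF = (discriminant W)%:~R.
  rewrite /discriminant /b8 /b2 /b4 /b6 /=.
  by rewrite !(rmorph_nat, rmorphXn, rmorphB, rmorphN, rmorphD, rmorphM).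
have /dvdnP[m Dm] : (4 %| #|[set u : 'F_p * 'F_p | on_affine WF u.1 u.2]%SET| + 1)%N.
  apply: (@card_weierstrass_points _ WF c%:~R s%:~R) => //.
  - by rewrite discE Fp_intr_eq0.
  - rewrite b2E b4E b6E -(rmorph0 intr) -Hc.
    move: (b2 W) (b4 W) (b6 W) => B2 B4 B6.
    by rewrite !(rmorph_nat, rmorphXn, rmorphD, rmorphM).
  - rewrite b2E b4E -rmorphXn Hs.
    move: (b2 W) (b4 W) => B2 B4.
    by rewrite !(rmorph_nat, rmorphXn, rmorphD, rmorphM).
exists (- m%:Z); rewrite /frobenius_trace Dm PoszM; ring.
Qed.

(** * Reduction at primes of good reduction *)

(** A conductor exponent 0 excludes the multiplicative and additive cases for
    one minimal model, hence for all of them, as their discriminants have the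
    same valuation. *)
Lemma good_reduction_of_conductor p E NE W :
  prime p -> ~~ (p %| NE)%N -> is_conductor E NE -> discriminant E != 0 ->
  is_minimal_model_at p E W -> ~~ (p %| `|discriminant W|)%N.
Proof.
move=> pr_p pNE [NE0 cond] DE [intW minW].
have logNE : logn p NE = 0%N by rewrite lognE pr_p NE0 (negPf pNE).
have [W' [intW' _]] := cond p pr_p; rewrite logNE.
have disc_log V : is_integral_model E V ->
    (p %| `|discriminant V|)%N = (logn p `|discriminant V| != 0)%N.
  move=> [u [r [s [t [uN0 chV]]]]].
  rewrite -lt0n logn_gt0 mem_primes pr_p /=.
  rewrite absz_gt0; have [D0|//] := eqVneq (discriminant V) 0.
  have := change_of_variables_discriminant chV.
  have -> : discriminant (map_weierstrass (intr : int -> rat) V) =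
            (discriminant V)%:~R.
    rewrite /discriminant /b8 /b2 /b4 /b6 /=.
    by rewrite !(rmorph_nat, rmorphXn, rmorphB, rmorphN, rmorphD, rmorphM).
  by rewrite D0 mulr0 => /eqP; rewrite eq_sym (negPf DE).
case: ifP => [|_]; last first.
  by case: ifP => _ // [delta _].
rewrite disc_log // negbK => /eqP log0 _.
by rewrite disc_log // negbK -leqn0 -log0 minW.
Qed.

Lemma frobenius_trace_2mod4 p E NE W :
  prime p -> (p %% 4 = 1)%N -> ~~ (p %| NE)%N -> is_conductor E NE ->
  discriminant E != 0 -> has_cyclic_rational_4_isogeny E ->
  is_minimal_model_at p E W ->
  exists z : int, frobenius_trace p W = 2 + 4 * z.
Proof.
move=> pr_p p4 pNE cond DE isog minW.
have goodW := good_reduction_of_conductor pr_p pNE cond DE minW.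
have [[u [r [s [t [uN0 chW]]]]] _] := minW.
have [x [v [Hx Hv]]] := cyclic4_rational_x isog.
have [Hx' Hv'] := change_of_variables_two_torsion uN0 chW Hx Hv.
have [c [d [Hc Hd]]] := integral_two_torsion Hx' Hv'.
have p_odd : odd p by have := divn_eq p 4; rewrite p4; lia.
have [j ->] := frobenius_trace_mod4 pr_p p_odd goodW Hc Hd.
exists ((p %/ 4)%N%:Z + j).
have := divn_eq p 4; rewrite p4; lia.
Qed.

(** * Convergence and uniqueness of power series *)

Section Convergence.
Variable F : numFieldType.
Implicit Types (s u : nat -> F) (l x : F).

(** Convergence spelled out, so that finite sums and subsequences are handled by
    elementary estimates in any numeric field. *)
Definition converges_to s l := forall eps : F, 0 < eps ->
  exists n0 : nat, forall n, (n0 <= n)%N -> `|l - s n| < eps.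

Lemma cvg_converges_to s l : s @ \oo --> (l : F^o) -> converges_to s l.
Proof.
move=> /(cvgrPdist_lt (V := F^o)) H eps eps0.
have [n0 _ Hn0] := H eps eps0; exists n0 => n len; exact: Hn0.
Qed.

Lemma converges_toD s1 s2 l1 l2 :
  converges_to s1 l1 -> converges_to s2 l2 ->
  converges_to (fun n => s1 n + s2 n) (l1 + l2).
Proof.
move=> H1 H2 eps eps0.
have [n1 Hn1] := H1 (eps / 2) (divr_gt0 eps0 (ltr0Sn _ 1)).
have [n2 Hn2] := H2 (eps / 2) (divr_gt0 eps0 (ltr0Sn _ 1)).
exists (maxn n1 n2) => n; rewrite geq_max => /andP[le1 le2].
rewrite opprD addrACA (le_lt_trans (ler_normD _ _)) //.
by rewrite [eps]splitr ltrD ?Hn1 ?Hn2.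
Qed.

Lemma converges_toZ k s l :
  converges_to s l -> converges_to (fun n => k * s n) (k * l).
Proof.
move=> H eps eps0.
have k1 : 0 < `|k| + 1 by rewrite ltr_wpDl.
have [n0 Hn0] := H (eps / (`|k| + 1)) (divr_gt0 eps0 k1).
exists n0 => n len; rewrite -mulrBr normrM.
rewrite (@le_lt_trans _ _ ((`|k| + 1) * `|l - s n|)) //.
  by rewrite ler_wpM2r // lerDl.
by rewrite mulrC -ltr_pdivlMr // Hn0.
Qed.

Lemma converges_toN s l :
  converges_to s l -> converges_to (fun n => - s n) (- l).
Proof.
by move=> H eps /H[n0 Hn0]; exists n0 => n /Hn0; rewrite -opprD normrN.
Qed.

Lemma converges_to_sum (I : Type) (r : seq I) (P : pred I)
    (s : I -> nat -> F) (l : I -> F) :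
  (forall i, P i -> converges_to (s i) (l i)) ->
  converges_to (fun n => \sum_(i <- r | P i) s i n) (\sum_(i <- r | P i) l i).
Proof.
move=> H; elim: r => [|i r IHr].
  by rewrite big_nil => eps eps0; exists 0%N => n _; rewrite big_nil subrr normr0.
rewrite big_cons; case: (boolP (P i)) => Pi.
  move=> eps /(converges_toD (H i Pi) IHr)[n0 Hn0].
  by exists n0 => n /Hn0; rewrite big_cons Pi.
move=> eps /IHr[n0 Hn0].
by exists n0 => n /Hn0; rewrite big_cons (negbTE Pi).
Qed.

Lemma converges_to_sub s l d : (0 < d)%N ->
  converges_to s l -> converges_to (fun n => s (d * n)%N) l.
Proof.
move=> d0 H eps /H[n0 Hn0]; exists n0 => n len; apply: Hn0.
by rewrite (leq_trans len) // leq_pmull.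
Qed.

Lemma converges_to_ext s s' l : s =1 s' -> converges_to s l -> converges_to s' l.
Proof. by move=> /funext ->. Qed.

Lemma converges_to_bounded s l : converges_to s l ->
  exists2 K, 0 <= K & forall n, `|s n| <= K.
Proof.
move=> /(_ 1 ltr01)[n0 Hn0].
exists (`|l| + 1 + \sum_(i < n0) `|s i|) => [|n].
  by rewrite !addr_ge0 // sumr_ge0.
have [lt|le] := ltnP n n0.
  rewrite (bigD1 (Ordinal lt)) //= ler_wpDl ?addr_ge0 // lerDl sumr_ge0 //.
rewrite (@le_trans _ _ (`|l| + 1)) ?lerDl ?sumr_ge0 //.
rewrite -[s n](subKr l) (le_trans (ler_normB _ _)) // lerD2l.
exact/ltW/Hn0.
Qed.

(** The general term of a convergent series is bounded. *)
Lemma power_series_coef_bound (c : nat -> F) l x : 0 < x -> 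
  converges_to (fun M => \sum_(m < M) c m * x ^+ m) l ->
  exists2 K, 0 <= K & forall m, `|c m| <= K * x^-1 ^+ m.
Proof.
move=> x0 /converges_to_bounded[K K0 HK].
exists (K + K) => [|m]; first by rewrite addr_ge0.
rewrite exprVn ler_pdivlMr ?exprn_gt0 //.
rewrite -[x in _ * x ^+ m](ger0_norm (ltW x0)) -normrX -normrM.
have -> : c m * x ^+ m =
    \sum_(i < m.+1) c i * x ^+ i - \sum_(i < m) c i * x ^+ i.
  by rewrite big_ord_recr /= addrAC subrr add0r.
by rewrite (le_trans (ler_normB _ _)) // lerD.
Qed.

Lemma geometric_tail_le (y : F) a n : 0 <= y -> y <= 1 / 2 ->
  \sum_(a <= m < a + n) y ^+ m <= 2 * y ^+ a.
Proof.
move=> y0 y1; elim: n a => [|n IHn] a.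
  by rewrite addn0 big_geq // mulr_ge0 // exprn_ge0.
rewrite big_ltn ?addnS ?ltnS ?leq_addr // -addSn.
rewrite (le_trans (lerD (lexx _) (IHn _))) // -subr_ge0.
rewrite (_ : _ - _ = 2 * y ^+ a * (1 / 2 - y)); last by rewrite exprS; field.
by rewrite !mulr_ge0 ?exprn_ge0 // subr_ge0.
Qed.

(** If m0 is the index of the first non-zero coefficient, then for small x the
    term of index m0 dominates the tail, which the geometric bound on the
    coefficients controls uniformly; so the partial sums stay away from 0.
    Convergence along multiples of d suffices for this, and is what averaging
    a Fourier expansion over translates provides. *)
Lemma power_series_eq0 (u : nat -> F) K B d : (0 < d)%N -> 0 <= K -> 0 <= B ->
  (forall m, `|u m| <= K * B ^+ m) ->
  (forall x, 0 < x < 1 ->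
     converges_to (fun M => \sum_(m < d * M) u m * x ^+ m) 0) ->
  forall m, u m = 0.
Proof.
move=> d0 K0 B0 leu Hu; elim/ltn_ind => m0 IH.
apply/eqP; apply: contraT => um0; set c := `|u m0|.
have c0 : 0 < c by rewrite normr_gt0.
(* x is small enough for the first non-zero term to dominate the tail *)
pose D := 2 * c + 2 * B * c + 4 * K * B ^+ m0.+1.
have T2 : 0 <= 2 * B * c by rewrite !mulr_ge0 // ltW.
have T3 : 0 <= 4 * K * B ^+ m0.+1 by rewrite !mulr_ge0 // exprn_ge0.
have T1 : 0 < 2 * c by rewrite mulr_gt0.
have D0 : 0 < D by rewrite /D -addrA ltr_wpDr ?addr_ge0.
pose x := c / D.
have x0 : 0 < x by rewrite divr_gt0.
have x1 : x < 1.
  rewrite ltr_pdivrMr // mul1r -subr_gt0.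
  rewrite (_ : _ - _ = c + (2 * B * c + 4 * K * B ^+ m0.+1)).
    by rewrite ltr_wpDr // addr_ge0.
  by rewrite /D; ring.
have Bx : B * x <= 1 / 2.
  rewrite /x mulrA ler_pdivrMr // mul1r ler_pdivlMl // -subr_ge0.
  rewrite (_ : _ - _ = 2 * c + 4 * K * B ^+ m0.+1); last by rewrite /D; ring.
  exact: addr_ge0 (ltW T1) T3.
have Kx : 2 * K * B ^+ m0.+1 * x <= c / 2.
  rewrite /x mulrA ler_pdivrMr // [leLHS]mulrC -[leRHS]mulrA ler_pM2l //.
  rewrite ler_pdivlMl // -subr_ge0 (_ : _ - _ = 2 * c + 2 * B * c).
    exact: addr_ge0 (ltW T1) T2.
  by rewrite /D; ring.
clearbody x; have x01 : 0 < x < 1 by rewrite x0.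
have [n0 Hn0] := Hu x x01 (x ^+ m0 * (c / 2))
  (mulr_gt0 (exprn_gt0 _ x0) (divr_gt0 c0 (ltr0Sn _ 1))).
pose n := maxn n0 m0.+1.
have := Hn0 n (leq_maxl _ _); rewrite sub0r normrN.
have len : (m0 < d * n)%N.
  by rewrite (@leq_trans n) ?leq_maxr // leq_pmull.
rewrite -(big_mkord xpredT (fun m => u m * x ^+ m)).
rewrite (big_cat_nat (n := m0.+1)) //= big_nat_recr //=.
rewrite big1_seq ?add0r; last first.
  by move=> i; rewrite mem_index_iota => /andP[_ /IH ->]; rewrite mul0r.
set T := \sum_(_ <= i < _) _ => lt.
have leT : `|T| <= x ^+ m0 * (c / 2).
  rewrite (le_trans (ler_norm_sum _ _ _)) //.
  rewrite (@le_trans _ _ (\sum_(m0.+1 <= i < d * n) K * (B * x) ^+ i)) //.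
    apply: ler_sum => i _; rewrite normrM normrX (ger0_norm (ltW x0)) exprMn mulrA.
      by rewrite ler_wpM2r ?exprn_ge0 // ltW.
  rewrite -mulr_sumr -(subnKC len).
  rewrite (le_trans (ler_wpM2l K0 (geometric_tail_le _ _ _ Bx))) //.
    by rewrite mulr_ge0 // ltW.
  rewrite exprMn [x ^+ m0.+1]exprSr.
  rewrite (_ : K * _ = x ^+ m0 * (2 * K * B ^+ m0.+1 * x)); last by ring.
  by rewrite ler_pM2l // exprn_gt0.
have := lerB_normD (u m0 * x ^+ m0) T.
rewrite normrM normrX (ger0_norm (ltW x0)) -/c => le2.
have := le_lt_trans le2 lt; rewrite ltrBlDr => lt3.
have := lt_le_trans lt3 (lerD (lexx _) leT).
by rewrite -mulrDr -splitr mulrC ltxx.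
Qed.

End Convergence.

(** * Hecke relations between Fourier coefficients *)

Section Hecke.
Variable R : realType.
Implicit Types (x y t : R) (f : R[i] -> R[i]) (c : nat -> R[i]).

Definition cis t : R[i] := cos t +i* sin t.

Lemma cisD s t : cis (s + t) = cis s * cis t.
Proof.
rewrite /cis cosD sinD; apply/eqP; rewrite eq_complex /=.
by rewrite [sin s * _ + _]addrC !eqxx.
Qed.

Lemma cis0 : cis 0 = 1.
Proof. by rewrite /cis cos0 sin0. Qed.

Lemma cis_natmul t n : cis (n%:R * t) = cis t ^+ n.
Proof.
elim: n => [|n IHn]; first by rewrite mul0r cis0.
by rewrite -natr1 mulrDl mul1r cisD IHn exprSr.
Qed.

Lemma cis_2pi n : cis (n%:R * (2 * pi)) = 1.
Proof.
rewrite cis_natmul /cis mulr_natl cos2pi.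
by rewrite sin2pi expr1n.
Qed.

Lemma cis_neq1 t : 0 < t < 2 * pi -> cis t != 1.
Proof.
move=> /andP[t0 t2]; apply/eqP => /(congr1 (@complex.Re R)) /= H.
have s0 : 0 < sin (t / 2).
  by apply: sin_gt0_pi; rewrite divr_gt0 //= ltr_pdivrMr // mulrC.
have : cos t = 1 - (sin (t / 2) ^+ 2) *+ 2.
  rewrite [in LHS](splitr t) cosD -!expr2.
  by rewrite cos2sin2 mulr2n opprD addrA.
rewrite H => /eqP; rewrite eq_sym subr_eq addrC -subr_eq subrr eq_sym.
by rewrite mulrn_eq0 expf_eq0 /= gt_eqF.
Qed.

(** Orthogonality of the characters of Z/d: a geometric sum of d-th roots of
    unity. *)
Lemma sum_cis d m : (0 < d)%N ->
  \sum_(b < d) cis (2 * pi * (b%:R / d%:R)) ^+ m =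
  if (d %| m)%N then d%:R else 0.
Proof.
move=> d0; have dN0 : d%:R != 0 :> R by rewrite pnatr_eq0 -lt0n.
pose z := cis (m%:R * (2 * pi / d%:R)).
have Ez : z = cis ((m %% d)%:R * (2 * pi / d%:R)).
  rewrite /z {1}(divn_eq m d) natrD natrM mulrDl cisD.
  rewrite (_ : _ * _ * (2 * pi / _) = (m %/ d)%:R * (2 * pi)); last by field.
  by rewrite cis_2pi mul1r.
have -> : \sum_(b < d) cis (2 * pi * (b%:R / d%:R)) ^+ m = \sum_(b < d) z ^+ b.
  apply: eq_bigr => b _; rewrite -!cis_natmul; congr cis; ring.
case: ifP => [/eqP|] dm.
  rewrite Ez dm mul0r cis0 (eq_bigr (fun=> 1)) => [|b _]; last by rewrite expr1n.
  by rewrite sumr_const card_ord.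
have z1 : z != 1.
  have r0 : (0 < m %% d)%N by rewrite lt0n; move: dm; rewrite /dvdn => ->.
  rewrite Ez; apply: cis_neq1; apply/andP; split.
    by rewrite mulr_gt0 ?ltr0n // divr_gt0 ?ltr0n // mulr_gt0 ?pi_gt0.
  rewrite mulrCA gtr_pMr ?mulr_gt0 ?pi_gt0 //.
  by rewrite ltr_pdivrMr ?ltr0n // mul1r ltr_nat ltn_mod.
apply: (mulfI (x := z - 1)); first by rewrite subr_eq0.
rewrite -subrX1 mulr0 /z -cis_natmul.
rewrite (_ : _ * (_ * _) = m%:R * (2 * pi)); last by field.
by rewrite cis_2pi subrr.
Qed.

Lemma qpar1E x y : qpar 1 (x +i* y) = (expR (- (2 * pi * y)))%:C * cis (2 * pi * x).
Proof. by rewrite /qpar /= !divr1. Qed.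

Lemma moebius_iy (a b d : nat) y : (0 < d)%N ->
  (a%:R * (0 +i* y) + b%:R) / d%:R = (b%:R / d%:R) +i* (a%:R * y / d%:R) :> R[i].
Proof.
move=> d0; have dN0 : d%:R != 0 :> R by rewrite pnatr_eq0 -lt0n.
have dN0' : d%:R != 0 :> R[i] by rewrite pnatr_eq0 -lt0n.
apply: (mulIf dN0'); rewrite divfK //.
have natE n : n%:R = n%:R%:C :> R[i] by rewrite rmorph_nat.
rewrite !natE; apply/eqP; rewrite eq_complex /=.
apply/andP; split; apply/eqP; rewrite ?mulr0 ?mul0r ?subr0 ?addr0 ?add0r;
  by field.
Qed.

Lemma fourier_converges f c x y : has_fourier_expansion 1 f c -> 0 < y ->
  converges_to (fun M => \sum_(m < M) c m *
    ((expR (- (2 * pi * y)))%:C ^+ m * cis (2 * pi * x) ^+ m)) (f (x +i* y)).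
Proof.
move=> Hf y0; have := Hf (x +i* y) y0.
move=> /cvg_converges_to; apply: converges_to_ext => M.
rewrite /series /= big_mkord; apply: eq_bigr => m _.
by rewrite qpar1E exprMn.
Qed.

Lemma sum_multiples (V : nmodType) (a L : nat) (g : nat -> V) : (0 < a)%N ->
  \sum_(m < a * L) (if (a %| m)%N then g (m %/ a)%N else 0) = \sum_(m < L) g m.
Proof.
move=> a0; elim: L => [|L IHL]; first by rewrite muln0 !big_ord0.
rewrite big_ord_recr -IHL /=.
pose G m := if (a %| m)%N then g (m %/ a)%N else 0.
rewrite -(big_mkord xpredT G) -(big_mkord xpredT G).
rewrite (big_cat_nat (n := (a * L)%N)) //=; last by rewrite leq_mul.
congr (_ + _).
rewrite mulnS addnC -{1}[(a * L)%N]add0n big_addn addKn big_mkord /G.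
rewrite (bigD1 (Ordinal a0)) //= add0n dvdn_mulr // mulKn // big1 ?addr0 // => i.
rewrite -val_eqE /= => iN0; rewrite dvdn_addl ?dvdn_mulr //.
by rewrite gtnNdvd // lt0n.
Qed.

(** Averaging over the translates b / d keeps the terms whose index is a
    multiple of d.  Only partial sums of length divisible by d are compared, which
    avoids rearranging series not known to converge absolutely. *)
Lemma fourier_average f c (a d : nat) y : has_fourier_expansion 1 f c ->
  (0 < a)%N -> (0 < d)%N -> 0 < y ->
  converges_to
    (fun M => \sum_(m < M)
       d%:R * c (d * m)%N * (expR (- (2 * pi * y)))%:C ^+ (a * m))
    (\sum_(b < d) f ((a%:R * (0 +i* y) + b%:R) / d%:R)).
Proof.
move=> Hf a0 d0 y0.
have dN0 : d%:R != 0 :> R by rewrite pnatr_eq0 -lt0n.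
have y0' : 0 < a%:R * y / d%:R by rewrite divr_gt0 ?mulr_gt0 ?ltr0n.
have := converges_to_sum (index_enum 'I_d) (P := xpredT)
  (fun (b : 'I_d) _ => fourier_converges (b%:R / d%:R) Hf y0').
rewrite (eq_bigr (fun b : 'I_d => f ((a%:R * (0 +i* y) + b%:R) / d%:R))); last first.
  by move=> b _; rewrite moebius_iy.
move=> /(converges_to_sub d0); apply: converges_to_ext => M.
set r := (expR (- (2 * pi * (a%:R * y / d%:R))))%:C.
have Er : r ^+ d = (expR (- (2 * pi * y)))%:C ^+ a.
  rewrite -!rmorphXn -!expRM_natl; congr (expR _)%:C; by field.
rewrite exchange_big /=.
transitivity (\sum_(m < M) d%:R * c (d * m)%N * r ^+ (d * m)).
  rewrite -(sum_multiples M (fun m => d%:R * c (d * m)%N * r ^+ (d * m)) d0).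
  apply: eq_bigr => m _; rewrite -mulr_sumr -mulr_sumr sum_cis //.
  case: ifP => [/dvdnP[q ->]|_]; last by rewrite !mulr0.
  by rewrite mulnK // [(d * q)%N]mulnC mulrA [LHS]mulrC mulrA.
by apply: eq_bigr => m _; rewrite exprM Er -exprM.
Qed.

(** The m-th Fourier coefficient of T_n f: the sum over the common divisors
    u of n and m prime to N of u^(w-1) c(m n / u^2), written with d = n / u. *)
Definition hecke_coef (w N n : nat) c (m : nat) : R[i] :=
  \sum_(d <- divisors n | coprime (n %/ d) N && (n %/ d %| m)%N)
    (n %/ d)%:R ^+ w.-1 * c (d * (m %/ (n %/ d)))%N.

Lemma hecke_expansion w N n f c y : has_fourier_expansion 1 f c ->
  (0 < w)%N -> (0 < n)%N -> 0 < y ->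
  converges_to
    (fun M => \sum_(m < n * M)
       hecke_coef w N n c m * (expR (- (2 * pi * y)))%:C ^+ m)
    (hecke w N n f (0 +i* y)).
Proof.
case: w => // w Hf _ n0 y0; set r := (expR _)%:C.
have dP d : d \in divisors n -> [/\ (0 < d)%N, (0 < n %/ d)%N & (n %/ d * d = n)%N].
  rewrite -dvdn_divisors // => dn.
  have d0 := dvdn_gt0 n0 dn.
  by rewrite d0 divn_gt0 // dvdn_leq // divnK.
rewrite /hecke mulr_sumr big_seq_cond.
rewrite /=; apply: (@converges_to_ext _ (fun M => \sum_(d <- divisors n |
    (d \in divisors n) && coprime (n %/ d) N)
  n%:R ^+ w * (d%:R ^- w.+1 *
    \sum_(m < d * M) d%:R * c (d * m)%N * r ^+ (n %/ d * m)))).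
  move=> M; rewrite /hecke_coef.
  under [RHS]eq_bigr => m _ do rewrite mulr_suml big_mkcond big_seq.
  rewrite exchange_big /= [LHS]big_mkcondr /=.
  apply: eq_bigr => d /dP[d0 a0 Dn].
  have nM : (n * M = n %/ d * (d * M))%N by rewrite mulnA Dn.
  case: (coprime _ _); last by rewrite big1.
  pose g m := (n %/ d)%:R ^+ w * c (d * m)%N * r ^+ (n %/ d * m).
  transitivity (\sum_(m < d * M) g m).
    rewrite !mulr_sumr; apply: eq_bigr => m _.
    rewrite /g !mulrA; congr (_ * _ * _).
    rewrite -{1}Dn natrM exprMn exprS /=.
    have dN0 : d%:R != 0 :> R[i] by rewrite pnatr_eq0 -lt0n.
    by field; rewrite dN0 expf_neq0.
  rewrite nM -(sum_multiples (d * M) g a0).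
  apply: eq_bigr => m _ /=; case: ifP => //= /dvdnP[q ->].
  by rewrite /g mulnK // [(q * _)%N]mulnC.
apply: converges_to_sum => d /andP[/dP[d0 a0 Dn] _].
apply: converges_toZ; rewrite -mulr_sumr; apply: converges_toZ.
exact: (converges_to_sub d0 (fourier_average Hf a0 d0 y0)).
Qed.

Lemma real_of_01 (x : R[i]) : 0 < x < 1 ->
  exists2 y : R, 0 < y & x = (expR (- (2 * pi * y)))%:C.
Proof.
case: x => r s; rewrite !ltcE /= => /andP[/andP[/eqP s0 r0] /andP[_ r1]].
have pi2 : 0 < 2 * pi :> R by rewrite mulr_gt0 ?pi_gt0.
exists (- ln r / (2 * pi)).
  by rewrite divr_gt0 // oppr_gt0 ln_lt0 // r0.
by rewrite mulrC divfK ?gt_eqF // opprK lnK ?posrE // s0.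
Qed.

Lemma fourier_coef_bound f c : has_fourier_expansion 1 f c ->
  exists K B, [/\ 0 <= K, 1 <= B & forall m, `|c m| <= K * B ^+ m].
Proof.
move=> Hf; pose x : R[i] := (expR (- (2 * pi * 1)))%:C.
have x0 : 0 < x by rewrite ltcR expR_gt0.
have := fourier_converges 0 Hf (ltr01 : 0 < 1 :> R); rewrite mulr0 cis0.
move=> H; have {}H : converges_to (fun M => \sum_(m < M) c m * x ^+ m) (f (0 +i* 1)).
  by apply: converges_to_ext H => M; apply: eq_bigr => m _; rewrite expr1n mulr1.
have [K K0 HK] := power_series_coef_bound x0 H.
exists K, x^-1; split=> //.
rewrite invf_ge1 // /x lecR -[leRHS]expR0 ler_expR oppr_le0.
by rewrite !mulr_ge0 // pi_ge0.
Qed.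

(** The points of the positive imaginary axis are enough to apply the uniqueness
    of power series, as there exp (2 i pi z) takes all the values in (0, 1). *)
Lemma hecke_coef_eigen w N n f c (lambda : R[i]) : has_fourier_expansion 1 f c ->
  (0 < w)%N -> (0 < n)%N ->
  (forall z, upper_half_plane z -> hecke w N n f z = lambda * f z) ->
  forall m, hecke_coef w N n c m = lambda * c m.
Proof.
move=> Hf w0 n0 Hn m; apply/eqP; rewrite -subr_eq0; apply/eqP; move: m.
have [K [B [K0 B1 HK]]] := fourier_coef_bound Hf.
have B0 : 0 <= B := le_trans ler01 B1.
pose S := \sum_(d <- divisors n) (n %/ d)%:R ^+ w.-1 : R[i].
have S0 : 0 <= S by apply: sumr_ge0 => d _; rewrite exprn_ge0.
apply: (@power_series_eq0 _ _ (S * K + `|lambda| * K) (B ^+ n) n) => //.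
- by rewrite addr_ge0 ?mulr_ge0.
- by rewrite exprn_ge0.
- move=> m; rewrite (le_trans (ler_normB _ _)) // mulrDl lerD //.
    rewrite (le_trans (ler_norm_sum _ _ _)) // -mulrA mulr_suml.
    rewrite [leRHS](bigID (fun d => coprime (n %/ d) N && (n %/ d %| m)%N)) /=.
    rewrite ler_wpDr ?sumr_ge0 // => [d _|].
      by rewrite mulr_ge0 ?exprn_ge0 // mulr_ge0 // !exprn_ge0.
    rewrite big_seq_cond [leRHS]big_seq_cond; apply: ler_sum => d /andP[dn _].
    rewrite normrM normrX normr_nat ler_wpM2l ?exprn_ge0 //.
    rewrite (le_trans (HK _)) // ler_wpM2l // -exprM ler_weXn2l //.
    rewrite -dvdn_divisors // in dn; rewrite leq_mul ?(dvdn_leq n0) //.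
    exact: leq_div.
  rewrite normrM -mulrA ler_wpM2l // (le_trans (HK _)) // ler_wpM2l //.
  by rewrite -exprM ler_weXn2l // leq_pmull.
move=> x /real_of_01[y y0 ->].
have H1 := hecke_expansion N Hf w0 n0 y0.
have H2 := fourier_converges 0 Hf y0.
have := converges_toD H1
  (converges_toN (converges_toZ lambda (converges_to_sub n0 H2))).
rewrite Hn // subrr; apply: converges_to_ext => M.
rewrite mulr_sumr -sumrB; apply: eq_bigr => i _.
by rewrite mulr0 cis0 expr1n mulr1 mulrBl mulrA.
Qed.

Lemma hecke_coef_coprime w N n c m : (0 < n)%N -> coprime n m ->
  hecke_coef w N n c m = c (n * m)%N.
Proof.
move=> n0 co_nm; rewrite /hecke_coef big_mkcond.
rewrite (bigD1_seq n) ?divisors_uniq -?dvdn_divisors //=.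
rewrite divnn n0 coprime1n dvd1n expr1n mul1r divn1 big1_seq ?addr0 // => d.
rewrite -dvdn_divisors // => /andP[dn dn']; case: ifP => // /andP[_ dm].
have : (n %/ d %| gcdn n m)%N by rewrite dvdn_gcd dm dvdn_div.
rewrite (eqP co_nm) dvdn1 => /eqP d1.
by move: dn; rewrite -(divnK dn') d1 mul1n eqxx.
Qed.

Section Eigenform.
Variables (w N : nat) (f : R[i] -> R[i]) (c : nat -> R[i]).
Hypotheses (w0 : (0 < w)%N) (Hf : is_normalized_cuspidal_eigenform w N f c).

(** The coefficient of index 1 in T_n f = lambda f identifies lambda as c n. *)
Lemma eigenform_hecke_coef n m : (0 < n)%N -> hecke_coef w N n c m = c n * c m.
Proof.
move=> n0; have [_ [_ Hc] /(_ n n0)[lambda Hl] c1] := Hf.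
have H := hecke_coef_eigen Hc w0 n0 Hl.
suff -> : c n = lambda by exact: H.
by rewrite -[RHS]mulr1 -c1 -H hecke_coef_coprime ?coprimen1 ?muln1.
Qed.

Lemma eigenform_coprimeM m n : (0 < m)%N -> coprime m n -> c (m * n)%N = c m * c n.
Proof.
by move=> m0 co_mn; rewrite -(hecke_coef_coprime w N) // eigenform_hecke_coef.
Qed.

Lemma eigenform_prime_recurrence p r : prime p -> ~~ (p %| N)%N ->
  c p * c (p ^ r.+1)%N = c (p ^ r.+2)%N + p%:R ^+ w.-1 * c (p ^ r)%N.
Proof.
move=> pr_p pN; have p0 := prime_gt0 pr_p.
rewrite -eigenform_hecke_coef // /hecke_coef big_mkcond.
rewrite (bigD1_seq p) ?divisors_uniq -?dvdn_divisors //=.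
rewrite divnn p0 coprime1n dvd1n expr1n mul1r divn1 -expnS; congr (_ + _).
rewrite big_mkcond (bigD1_seq 1%N) ?divisors_uniq -?dvdn_divisors //=.
rewrite divn1 neq_ltn prime_gt1 // prime_coprime // pN dvdn_exp //=.
rewrite mul1n expnS mulKn // big1_seq ?addr0 // => d.
rewrite -dvdn_divisors // => /andP[d1 /(primeP pr_p).2/orP[]]; first by rewrite (negPf d1).
by move=> ->.
Qed.
End Eigenform.

End Hecke.

(** For a p = 0 the recurrence reads c(p^(r+2)) = - p^(w-1) c(p^r). *)
Lemma eigenform_even_prime_power (R : realType) (w N : nat) (f : R[i] -> R[i])
    (c : nat -> R[i]) p r :
  (0 < w)%N -> is_normalized_cuspidal_eigenform w N f c ->
  prime p -> ~~ (p %| N)%N -> c p = 0 -> c (p ^ (2 * r))%N != 0.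
Proof.
move=> w0 Hf pr_p pN cp0; elim: r => [|r IHr].
  by have [_ _ _ c1] := Hf; rewrite muln0 expn0 c1 oner_neq0.
have /esym/eqP := eigenform_prime_recurrence w0 Hf (2 * r)%N pr_p pN.
rewrite cp0 mul0r addr_eq0 mulnS => /eqP ->.
by rewrite oppr_eq0 mulf_neq0 // expf_neq0 // pnatr_eq0 -lt0n prime_gt0.
Qed.

(** * Sums of two squares *)

(** Otherwise - 1 would be a square modulo p, although its power of odd exponent
    (p - 1) / 2 is - 1. *)
Lemma dvdn_sum_squares p x y : prime p -> (p %% 4 = 3)%N ->
  (p %| x ^ 2 + y ^ 2)%N -> (p %| x)%N /\ (p %| y)%N.
Proof.
move=> pr_p p3 dvd_p.
have natE n : (n%:R == 0 :> 'F_p) = (p %| n)%N.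
  by rewrite (dvdn_pcharf (pchar_Fp pr_p)).
have E : x%:R ^+ 2 + y%:R ^+ 2 = 0 :> 'F_p.
  by rewrite -!natrX -natrD; apply/eqP; rewrite natE.
have y0 : y%:R = 0 :> 'F_p.
  apply/eqP; apply: contraT => yN0.
  pose z : 'F_p := x%:R / y%:R.
  have z2 : z ^+ 2 = -1.
    rewrite expr_div_n (_ : x%:R ^+ 2 = - y%:R ^+ 2) ?mulNr ?divff ?expf_neq0 //.
    by apply/eqP; rewrite -addr_eq0 E.
  have zp : z ^+ p = z by have := expf_card z; rewrite card_Fp.
  have zN0 : z != 0.
    by apply/eqP => z0; move/eqP: z2; rewrite z0 expr0n eq_sym oppr_eq0 oner_eq0.
  have : z ^+ p.-1 = 1.
    apply: (mulfI zN0); rewrite -exprS prednK ?prime_gt0 //.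
    by rewrite zp mulr1.
  have -> : p.-1 = (2 * (2 * (p %/ 4)).+1)%N.
    have := divn_eq p 4; rewrite p3; lia.
  rewrite exprM z2 -signr_odd /= oddM /= expr1 => /eqP.
  rewrite eq_sym -subr_eq0 opprK -(natrD _ 1 1) natE.
  by rewrite dvdn_prime2 // => /eqP p2; rewrite p2 in p3.
split; rewrite -natE; last by rewrite y0.
by move/eqP: E; rewrite y0 expr0n addr0 expf_eq0.
Qed.

Lemma logn_sum_squares p x y : prime p -> (p %% 4 = 3)%N ->
  ~~ odd (logn p (x ^ 2 + y ^ 2)).
Proof.
move=> pr_p p3; have [n] := ubnP (x + y); elim: n x y => // n IHn x y le_n.
have [dvd_p|ndvd] := boolP (p %| x ^ 2 + y ^ 2)%N; last first.
  by rewrite lognE pr_p (negPf ndvd) andbF.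
have [/dvdnP[x1 Dx] /dvdnP[y1 Dy]] := dvdn_sum_squares pr_p p3 dvd_p.
have [|xy0] := posnP (x + y).
  by move/eqP; rewrite addn_eq0 => /andP[/eqP-> /eqP->]; rewrite logn0.
have p1 := prime_gt1 pr_p.
have -> : (x ^ 2 + y ^ 2 = p ^ 2 * (x1 ^ 2 + y1 ^ 2))%N.
  by rewrite Dx Dy !expnMn -mulnDl mulnC.
have xy1 : (0 < x1 ^ 2 + y1 ^ 2)%N.
  rewrite lt0n; apply: contraTneq xy0 => /eqP.
  by rewrite Dx Dy addn_eq0 !expn_eq0 /= !andbT => /andP[/eqP-> /eqP->].
have p20 : (0 < p ^ 2)%N by rewrite expn_gt0 (ltnW p1).
rewrite lognM // (pfactorK 2 pr_p) oddD /=.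
apply: IHn; nia.
Qed.

(** Here w is the last multiple of L before y, or 0 if y = 0.  By the choice of y,
    w^2 < n - x^2, so that y^2 - (n - x^2) <= (w + L)^2 - w^2. *)
Lemma sum_squares_near (L n : nat) : (0 < L)%N -> (0 < n)%N ->
  exists x y e w : nat,
    [/\ (x ^ 2 + y ^ 2 = n + e)%N, coprime (x ^ 2 + y ^ 2) L,
        (e <= 2 * L * w + L ^ 2)%N, (w ^ 2 <= 3 * L ^ 2 * x)%N & (x ^ 2 <= n)%N].
Proof.
move=> L0 n0.
have [||s Hs max_s] := @ex_maxnP (fun s => (1 + L * s) ^ 2 <= n)%N n.
- by exists 0%N; rewrite muln0.
- by move=> s; nia.
pose x := (1 + L * s)%N; pose D := (n - x ^ 2)%N.
have HD : (D < L * (2 * x + L))%N.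
  have : ~~ ((1 + L * s.+1) ^ 2 <= n)%N.
    by apply/negP => /max_s; rewrite ltnn.
  rewrite /D /x; nia.
have [|u Hu min_u] := @ex_minnP (fun u => D <= (L * u) ^ 2)%N.
  by exists D; nia.
have min_D v : (forall k, (D <= (L * k) ^ 2)%N -> (v.+1 <= k)%N) ->
    ((L * v) ^ 2 < D)%N.
  by move=> min_v; rewrite ltnNge; apply/negP => /min_v; rewrite ltnn.
exists x, (L * u)%N, ((L * u) ^ 2 - D)%N, (L * u.-1)%N; split.
- by rewrite /D in Hu *; lia.
- rewrite (_ : x ^ 2 + (L * u) ^ 2 =
    (2 * s + L * s ^ 2 + L * u ^ 2) * L + 1)%N; last by rewrite /x; nia.
  by rewrite /coprime gcdnC gcdnMDl gcdn1.
- case: u Hu min_u => [|u] Hu min_u; first by lia.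
  have := min_D u min_u; have : ((L * u.+1) ^ 2 = (L * u) ^ 2 + (2 * L * (L * u) + L ^ 2))%N.
    by ring.
  rewrite /=; lia.
- case: u Hu min_u => [|u] Hu min_u; first by rewrite muln0.
  have lt_D := min_D u min_u.
  have x1 : (0 < x)%N by rewrite /x.
  rewrite /= (leq_trans (ltnW lt_D)) // (leq_trans (ltnW HD)) //.
  by clearbody x D; nia.
- exact: Hs.
Qed.

(** The hypotheses give w^4 <= 9 L^4 n, so w <= 2 L n^(1/4), and 1 <= n^(1/4) absorbs
    the term L^2. *)
Lemma le_fourth_root (R : realType) (L n e w x : nat) : (0 < n)%N ->
  (e <= 2 * L * w + L ^ 2)%N -> (w ^ 2 <= 3 * L ^ 2 * x)%N -> (x ^ 2 <= n)%N ->
  e%:R <= 5 * L%:R ^+ 2 * n%:R `^ (4^-1) :> R.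
Proof.
move=> n0 He Hw Hx; set v := n%:R `^ (4^-1).
have v0 : 0 <= v by apply: powR_ge0.
have v4 : v ^+ 4 = n%:R.
  by rewrite -powR_mulrn // -powRrM mulVf ?powRr1.
have v1 : 1 <= v.
  by rewrite -(@ler_pXn2r _ 4) ?nnegrE // expr1n v4 ler1n.
have wv : w%:R <= 2 * L%:R * v.
  rewrite -(@ler_pXn2r _ 4) ?nnegrE ?mulr_ge0 //.
  rewrite exprMn v4 -natrM -!natrX -natrM ler_nat.
  have : ((w ^ 2) ^ 2 <= (3 * L ^ 2 * x) ^ 2)%N by rewrite leq_exp2r.
  rewrite -expnM /= => /leq_trans; apply.
  rewrite (_ : (3 * L ^ 2 * x) ^ 2 = 9 * L ^ 4 * x ^ 2)%N; last by ring.
  by rewrite expnMn leq_mul // leq_mul.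
rewrite (@le_trans _ _ ((2 * L * w + L ^ 2)%:R)) ?ler_nat //.
rewrite natrD natrX !natrM.
have Lw : L%:R * w%:R <= L%:R * (2 * L%:R * v) :> R by rewrite ler_wpM2l.
have Lv : L%:R ^+ 2 * 1 <= L%:R ^+ 2 * v :> R by rewrite ler_wpM2l // exprn_ge0.
lra.
Qed.

(** * Powers of a prime ideal above 2 *)

Section Ideals.
Variables (F : fieldType) (O q : set F).
Hypothesis q_prime : is_prime_ideal O q.
Hypothesis q2 : lies_above q 2.

Lemma ideal_mulS (I J J' : set F) : J `<=` J' -> ideal_mul I J `<=` ideal_mul I J'.
Proof.
move=> sJ x [s [Hs ->]]; exists s; split=> // u us.
by have [Iu /sJ Ju] := Hs u us.
Qed.

Lemma ideal_mulD (I J : set F) x y : ideal_mul I J x -> ideal_mul I J y ->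
  ideal_mul I J (x + y).
Proof.
move=> [s [Hs ->]] [t [Ht ->]]; exists (s ++ t); split; last by rewrite big_cat.
by move=> u; rewrite mem_cat => /orP[/Hs|/Ht].
Qed.

Lemma ideal_mulM (I J : set F) x y : I x -> J y -> ideal_mul I J (x * y).
Proof.
move=> Ix Jy; exists [:: (x, y)]; split; last by rewrite big_seq1.
by move=> u; rewrite inE => /eqP ->.
Qed.

(** Since q is contained in O, multiplying by q shrinks ideals. *)
Lemma ideal_exp_decr m : ideal_exp O q m.+1 `<=` ideal_exp O q m.
Proof.
have [[qO q_0 qD qM] _ _] := q_prime.
elim: m => [|m IHm]; last exact: ideal_mulS.
move=> x [s [Hs ->]]; apply: qO; elim: s Hs => [|u s IHs] Hs.
  by rewrite big_nil.
rewrite big_cons; apply: qD; last by apply: IHs => v vs; apply: Hs; rewrite inE vs orbT.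
have [qu Ou] := Hs u (mem_head _ _).
by rewrite mulrC; apply: qM.
Qed.

Lemma ideal_exp_le m n : (m <= n)%N -> ideal_exp O q n `<=` ideal_exp O q m.
Proof.
move=> /subnK <-; elim: (n - m)%N => [|k IHk] //.
by move=> x; rewrite addSn => /ideal_exp_decr/IHk.
Qed.

(** The element 4z is (2z) * 2 with 2z in q and 2 in q^e, so it lies in
    q^(e+1); if 2 + 4z did too, so would 2. *)
Lemma two_mod4_notin_ideal_exp e m (z : int) :
  is_ramification_index O q 2 e -> (e < m)%N ->
  ~ ideal_exp O q m (2 + 4 * z)%:~R.
Proof.
move=> [q2e nq2e] lt_em /(ideal_exp_le lt_em) Hz; apply: nq2e.
have -> : 2%:R = (2 + 4 * z)%:~R + (2 * (- z))%:~R * 2%:R :> F.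
  by rewrite !(rmorphD, rmorphM, rmorphN) /=; ring.
apply: ideal_mulD => //; apply: ideal_mulM => //.
by apply/q2; rewrite dvdz_mulr.
Qed.

End Ideals.

(** * Non-vanishing coefficients and gaps *)

(** Split off the full power of a prime factor of n; the parity condition on the
    exponents is inherited by the cofactor. *)
Lemma multiplicative_neq0 (F : fieldType) (c : nat -> F) (M : nat) :
  (forall m n, (0 < m)%N -> coprime m n -> c (m * n)%N = c m * c n) -> c 1%N = 1 ->
  (forall p r, prime p -> ~~ (p %| M)%N -> (p %% 4 = 1)%N -> c (p ^ r)%N != 0) ->
  (forall p r, prime p -> ~~ (p %| M)%N -> (p %% 4 = 3)%N -> c (p ^ (2 * r))%N != 0) ->
  (2 %| M)%N ->
  forall n, (0 < n)%N -> coprime n M ->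
    (forall p, prime p -> (p %% 4 = 3)%N -> ~~ odd (logn p n)) -> c n != 0.
Proof.
move=> cM c1 c_1mod4 c_3mod4 M2 n; have [k] := ubnP n.
elim: k n => // k IHk n le_k n0 co_n even_n.
have [n1|n1] := leqP n 1.
  by have -> : n = 1%N; [lia | rewrite c1 oner_neq0].
pose p := pdiv n; have pr_p : prime p := pdiv_prime n1.
have pn : (p %| n)%N := pdiv_dvd n.
have pM : ~~ (p %| M)%N by rewrite -prime_coprime // (coprime_dvdl pn).
have Dn := partnC p n0; rewrite p_part in Dn.
set v := logn p n in Dn; set m := (n`_p^')%N in Dn.
have v0 : (0 < v)%N by rewrite logn_gt0 mem_primes pr_p n0.
have m0 : (0 < m)%N by rewrite part_gt0.
have mn : (m %| n)%N := dvdn_part _ _.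
have co_pm : coprime (p ^ v) m by rewrite -p_part coprime_partC.
rewrite -Dn cM ?expn_gt0 ?prime_gt0 // mulf_neq0 //.
  have : (p %% 4 = 1 \/ p %% 4 = 3)%N.
    have : p <> 2 by move=> p2; rewrite p2 M2 in pM.
    have := even_prime pr_p; have := divn_eq p 4; have := ltn_mod p 4; lia.
  case=> p4; first exact: c_1mod4.
  rewrite -[v](odd_double_half v) (negPf (even_n p pr_p p4)) add0n -mul2n.
  exact: c_3mod4.
apply: IHk => //.
- have : (1 < p ^ v)%N by rewrite -(exp1n v) ltn_exp2r // prime_gt1.
  nia.
- exact: coprime_dvdl mn co_n.
- move=> q pr_q q4; have := even_n q pr_q q4.
  have pv0 : (0 < p ^ v)%N by rewrite expn_gt0 prime_gt0.
  have := lognM q pv0 m0; rewrite Dn => ->.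
  rewrite oddD lognX logn_prime //.
  case: eqP => [Eq|_]; last by rewrite muln0.
  by rewrite muln1 Eq (negPf (even_n p pr_p _)) // -Eq.
Qed.

Lemma gap_exists (R : realType) (a : nat -> R[i]) n e : a (n + e)%N != 0 ->
  exists2 i, is_gap a n i & (i <= e)%N.
Proof.
move=> ae; have [an0|anN0] := eqVneq (a n) 0; last first.
  by exists 0%N => //; split=> // an0; rewrite an0 eqxx in anN0.
have [|j aj min_j] := @ex_minnP (fun j => a (n + j)%N != 0); first by exists e.
case: j aj min_j => [|j] aj min_j; first by rewrite addn0 an0 eqxx in aj.
exists j; last exact/ltnW/min_j.
split=> [|_]; first by rewrite an0 eqxx.
split=> [i le_ij|i Hi].
  by apply/eqP; apply: contraTT le_ij => /min_j; rewrite -ltnNge.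
by rewrite leqNgt; apply/negP => /Hi Hj; rewrite Hj eqxx in aj.
Qed.

Theorem theorem4p2 (R : realType) :
  exists C : nat -> R, (forall t, 0 < C t) /\
  forall (k N : nat) (f : R[i] -> R[i]) (a : nat -> R[i]) (Mf : nat)
         (q : set R[i]) (e m : nat)
         (E : weierstrass rat) (NE : nat)
         (fE : R[i] -> R[i]) (aE : nat -> R[i]),
    (1 < k)%N -> (1 <= N)%N ->
    is_normalized_cuspidal_eigenform (2 * k) N f a ->
    (1 <= Mf)%N ->
    (forall p, prime p -> ~~ (p %| Mf)%N ->
       a p = 0 \/ forall r, (1 <= r)%N -> a (p ^ r)%N != 0) ->
    let OK := ring_of_integers (coefficient_field a) in
    is_prime_ideal OK q -> lies_above q 2 ->
    is_ramification_index OK q 2 e ->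
    discriminant E != 0 -> is_conductor E NE ->
    has_cyclic_rational_4_isogeny E ->
    is_modular_form_of E NE fE aE ->
    (e < m)%N -> congruent_mod (ideal_exp OK q m) a aE ->
    exists n0 : nat, forall n, (n0 <= n)%N ->
      exists2 i : nat, is_gap a n i &
        i%:R <= C (lcmn N Mf * NE)%N * n%:R `^ (4^-1).
Proof.
(* 20 t^2 is 5 L^2 for L = 2t; the added 1 keeps the constant positive at 0 *)
exists (fun t => 20 * t%:R ^+ 2 + 1); split.
  by move=> t; rewrite ltr_wpDl ?mulr_ge0 ?exprn_ge0.
move=> k N f a Mf q e m E NE fE aE k1 N0 Hf Mf0 Ha OK q_prime q2 ram DE cond isog
  [_ HaE] lt_em cong.
have w0 : (0 < 2 * k)%N by lia.
set M := (lcmn N Mf * NE)%N.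
have [NE0 _] := cond.
have M0 : (0 < M)%N by rewrite muln_gt0 lcmn_gt0 N0 Mf0.
have pM p : ~~ (p %| 2 * M)%N -> [/\ ~~ (p %| N)%N, ~~ (p %| Mf)%N & ~~ (p %| NE)%N].
  move=> H; split; apply: contra H => H; apply: dvdn_mull.
  - by apply: dvdn_mulr; apply: dvdn_trans (dvdn_lcml _ _).
  - by apply: dvdn_mulr; apply: dvdn_trans (dvdn_lcmr _ _).
  - exact: dvdn_mull.
have a1 : a 1%N = 1 by case: Hf.
have a_neq0 n : (0 < n)%N -> coprime n (2 * M) ->
    (forall p, prime p -> (p %% 4 = 3)%N -> ~~ odd (logn p n)) -> a n != 0.
  apply: multiplicative_neq0 => //.
  - by move=> m' n' m0 co; exact: (eigenform_coprimeM w0 Hf m0 co).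
  - move=> p r pr_p /pM[pN pMf pNE] p4.
    have ap : a p != 0.
      apply/eqP => ap0; have [W minW Dap] := HaE p pr_p.
      have [z Dz] := frobenius_trace_2mod4 pr_p p4 pNE cond DE isog minW.
      (* - (2 + 4z) is again congruent to 2 modulo 4 *)
      apply: (two_mod4_notin_ideal_exp q_prime q2 (z := - z - 1) ram lt_em).
      have := cong p; rewrite ap0 Dap Dz sub0r -rmorphN.
      by congr (ideal_exp _ _ _ _%:~R); ring.
    case: r => [|r]; first by rewrite expn0 a1 oner_neq0.
    by have [ap0|] := Ha p pr_p pMf; [rewrite ap0 eqxx in ap | apply].
  - move=> p r pr_p /pM[pN pMf pNE] p4.
    have [ap0|] := Ha p pr_p pMf.
      exact: (eigenform_even_prime_power r w0 Hf pr_p pN ap0).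
    by case: r => [|r]; [rewrite expn0 a1 oner_neq0 | apply].
  - exact: dvdn_mulr.
exists 1%N => n n0.
(* the modulus 2 * M makes the sum of two squares odd as well *)
have L0 : (0 < 2 * M)%N by rewrite muln_gt0.
have [x [y [g [w [Dg co_g le_g le_w le_x]]]]] := sum_squares_near L0 n0.
have [|i gap_i le_ig] := @gap_exists R a n g.
  rewrite -Dg; apply: a_neq0 => //; first by rewrite Dg addn_gt0 n0.
  by move=> p pr_p p4; exact: logn_sum_squares.
exists i => //.
rewrite (@le_trans _ _ g%:R) ?ler_nat //.
rewrite (le_trans (le_fourth_root R n0 le_g le_w le_x)) // ler_wpM2r ?powR_ge0 //.
by rewrite natrM exprMn; lra.
Qed.
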